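(* Let $\sigma$ and $\omega$ be locally finite Borel measures on $\mathbb{R}^d$ that satisfy the dyadic Fujii–Wilson $A_\infty$ condition with respect to each other, i.e. $[\sigma]_{A_\infty(\omega)}<\infty$ and $[\omega]_{A_\infty(\sigma)}<\infty$. Let $\lambda=\{\lambda_Q\}_{Q\in\mathcal{D}}$ be a family of non-negative reals, and let $p\in(1,\infty)$ and $q\in(0,\infty)$ be such that $q<p$. Put $$I_{\sigma,\omega,p,q,\lambda}:=\left(\int\Big(\sum_{Q\in\mathcal{D}}\lambda_Q\Big(\frac{\omega(Q)}{\sigma(Q)}\Big)^{\frac1q}1_Q\Big)^{\frac{pq}{p-q}}d\sigma\right)^{\frac{p-q}{pq}}.$$ Then there are constants $c_1,c_2\in(0,\infty)$ depending only on $p,q$ such that: • if $q\in(0,1]$, then $$c_1[\omega]_{A_\infty(\sigma)}^{-\frac{1-q}{q}}I_{\sigma,\omega,p,q,\lambda}\le\|T_\lambda(\cdot\,\sigma)\|_{L^p(\sigma)\to L^q(\omega)}\le c_2[\sigma]_{A_\infty(\omega)}^{\frac{1-q}{q}}I_{\sigma,\omega,p,q,\lambda};$$ • if $q\in(1,\infty)$, then $$c_1[\sigma]_{A_\infty(\omega)}^{-\frac{q-1}{q}}I_{\sigma,\omega,p,q,\lambda}\le\|T_\lambda(\cdot\,\sigma)\|_{L^p(\sigma)\to L^q(\omega)}\le c_2[\omega]_{A_\infty(\sigma)}^{\frac{q-1}{q}}I_{\sigma,\omega,p,q,\lambda}.$$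
   Context: $\mathcal{D}$ is the collection of all dyadic cubes in $\mathbb{R}^d$. For a measure $\mu$ and $Q\in\mathcal D$, $\langle f\rangle^\mu_Q:=\frac{1}{\mu(Q)}\int_Q|f|\,d\mu$. The dyadic summation operator is $T_\lambda(f\sigma):=\sum_{Q\in\mathcal{D}}\lambda_Q\langle f\rangle^\sigma_Q1_Q$, and $\|T_\lambda(\cdot\,\sigma)\|_{L^p(\sigma)\to L^q(\omega)}\in[0,\infty]$ is the least constant $C$ such that $\|T_\lambda(f\sigma)\|_{L^q(\omega)}\le C\|f\|_{L^p(\sigma)}$ for all $f\in L^p(\sigma)$ (where $\|f\|_{L^q(\omega)}=(\int|f|^q\,d\omega)^{1/q}$ for every $q\in(0,\infty)$). The Fujii–Wilson $A_\infty$ characteristic $[\sigma]_{A_\infty(\omega)}$ is the least constant $C$ such that $$\int\sup_{R\in\mathcal{D}:R\subseteq Q}\Big(\frac{\sigma(R)}{\omega(R)}1_R\Big)d\omega\le C\,\sigma(Q)\quad\text{for every }Q\in\mathcal{D};$$ $[\omega]_{A_\infty(\sigma)}$ is defined by interchanging $\sigma$ and $\omega$. Conventions: $\frac00:=0$ and $0\cdot\infty:=0$; expressions may take the value $\infty$. *)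

(* Defs.v *)
From HB Require Import structures.
From mathcomp Require Import all_boot all_order all_algebra.
From mathcomp Require Import all_classical all_reals all_analysis.

Set Implicit Arguments.
Unset Strict Implicit.
Unset Printing Implicit Defensive.

Import Order.TTheory GRing.Theory Num.Theory.
Import numFieldTopology.Exports numFieldNormedType.Exports.

Local Open Scope classical_set_scope.
Local Open Scope ring_scope.

(* R^d with its Borel sigma-algebra, the one generated by the open sets. *)
Notation Rd R d := (g_sigma_algebraType (@open 'rV[R]_d)).

Definition locally_finite (R : realType) (d : nat)
    (mu : {measure set (Rd R d) -> \bar R}) : Prop :=
  forall x : 'rV[R]_d,
    exists U : set 'rV[R]_d, [/\ open U, U x & (mu U < +oo)%E].

(* 2^k ([0,1)^d + m); k ranges over all integers, so the sign of the exponent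
   is immaterial. *)
Definition dyadic_cube (R : realType) (d : nat) (k : int) (m : 'rV[int]_d) :
    set (Rd R d) :=
  [set x : 'rV[R]_d | forall i : 'I_d,
    x ord0 i \in `[(m ord0 i)%:~R * 2 ^ k, ((m ord0 i)%:~R + 1) * 2 ^ k[ ].

Definition dyadic_cubes (R : realType) (d : nat) : set (set (Rd R d)) :=
  [set Q | exists k m, Q = dyadic_cube k m].

Arguments dyadic_cubes : clear implicits.

Local Open Scope ereal_scope.

(* In \bar R one has 0^-1 = +oo and 0 * +oo = 0, hence 0 / 0 = 0. *)

Definition average (R : realType) (d : nat)
    (mu : {measure set (Rd R d) -> \bar R}) (f : Rd R d -> R)
    (Q : set (Rd R d)) : \bar R :=
  (mu Q)^-1 * \int[mu]_(x in Q) `|(f x)%:E|.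

(* T_lambda(f sigma); only the values of lambda on dyadic cubes matter. *)
Definition dyadic_summation (R : realType) (d : nat)
    (lambda : set (Rd R d) -> R) (sigma : {measure set (Rd R d) -> \bar R})
    (f : Rd R d -> R) (x : Rd R d) : \bar R :=
  \esum_(Q in dyadic_cubes R d)
    ((lambda Q)%:E * average sigma f Q * (\1_Q x)%:E).

(* The infimum is over real constants and equals +oo when there is none. *)
Definition dyadic_operator_norm (R : realType) (d : nat)
    (lambda : set (Rd R d) -> R) (sigma omega : {measure set (Rd R d) -> \bar R})
    (p q : R) : \bar R :=
  ereal_inf [set C%:E | C in [set C : R | (0 <= C)%R /\
    forall f : Rd R d -> R, f \in Lfun sigma p%:E ->
      'N[omega]_(q%:E) [dyadic_summation lambda sigma f] <=
        C%:E * 'N[sigma]_(p%:E) [EFin \o f] ]].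

(* [sigma]_{A_oo(omega)}; again an infimum over real constants. *)
Definition Ainfty_char (R : realType) (d : nat)
    (sigma omega : {measure set (Rd R d) -> \bar R}) : \bar R :=
  ereal_inf [set C%:E | C in [set C : R | (0 <= C)%R /\
    forall Q, dyadic_cubes R d Q ->
      \int[omega]_x
          ereal_sup [set sigma S / omega S * (\1_S x)%:E
                    | S in [set S | dyadic_cubes R d S /\ S `<=` Q]]
        <= C%:E * sigma Q ]].

Definition I_integral (R : realType) (d : nat)
    (sigma omega : {measure set (Rd R d) -> \bar R}) (p q : R)
    (lambda : set (Rd R d) -> R) : \bar R :=
  (\int[sigma]_x
     (\esum_(Q in dyadic_cubes R d)
        ((lambda Q)%:E * (omega Q / sigma Q) `^ (1 / q) * (\1_Q x)%:E))
       `^ (p * q / (p - q))) `^ ((p - q) / (p * q)).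

(* Main.v *)
Require Import Defs.
From HB Require Import structures.
From mathcomp Require Import all_boot all_order all_algebra.
From mathcomp Require Import finmap all_classical all_reals all_analysis.
From mathcomp Require Import measurable_realfun ring lra.

Set Implicit Arguments.
Unset Strict Implicit.
Unset Printing Implicit Defensive.

Import Order.TTheory GRing.Theory Num.Theory.
Import numFieldTopology.Exports numFieldNormedType.Exports.

Local Open Scope classical_set_scope.
Local Open Scope ring_scope.

(** By monotone convergence it suffices to bound finite families of cubes
    charged by both measures.  List such a family Q_0, ..., Q_(n-1) so that each
    cube is contained in, or disjoint from, every earlier one.  For b >= 0 put
    S_j = the sum of the b_i over the i <= j with Q_j contained in Q_i; then the
    q-th power of the sum of the b_j 1_(Q_j) telescopes into the sum of the
    d_j 1_(Q_j), where d_j = S_j^q - (S_j - b_j)^q >= 0 is comparable with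
    b_j S_j^(q-1) from one side.

    For q <= 1 and a = b (sigma/omega)^(1/q) one has, pointwise,
      sum_j a_j 1_(Q_j)
        <= (sum_j b_j S_j^(q-1) (sigma/omega)(Q_j) 1_(Q_j)) v^((1-q)/q),
    where v = sum_j d_j max_(Q_i in Q_j) (sigma/omega)(Q_i) 1_(Q_i) has
    omega-integral at most [sigma]_(A_oo(omega)) sum_j d_j sigma(Q_j).  Hoelder's
    inequality with exponents 1/q and 1/(1-q) then bounds the L^q(omega) norm of
    sum_j a_j 1_(Q_j) by that of sum_j b_j 1_(Q_j) in L^q(sigma).  For q > 1 one
    argues in the same way starting from the opposite comparison, and absorbs.
    This replaces omega by sigma at the price of the A_oo factors, and exchanging
    the measures gives the converse.

    What remains is the one-weight operator with coefficients
    mu_Q = lambda_Q (omega(Q)/sigma(Q))^(1/q).  It is at most the dyadic maximal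
    function of f times g = sum_Q mu_Q 1_Q, which gives the upper bound, and
    testing it on f = g^(q/(p-q)) gives the lower bound. *)

(** * Power inequalities *)

Section powR_inequalities.
Context {R : realType}.
Implicit Types (a q s t x y : R).

Lemma powR_le q x y : 0 <= q -> 0 <= x -> x <= y -> x `^ q <= y `^ q.
Proof.
by move=> q0 x0 xy; apply: ge0_ler_powR => //; rewrite nnegrE// (le_trans x0).
Qed.

(** Young's inequality for [x] and [y^(a-1)] with the conjugate exponents [a] and [a/(a-1)], cleared
    of denominators. The next three estimates are instances of it. *)
Lemma powR_young a x y : 1 <= a -> 0 <= x -> 0 <= y ->
  a * x * y `^ (a - 1) <= x `^ a + (a - 1) * y `^ a.
Proof.
move=> a1 x0 y0; have a0 : 0 < a by exact: lt_le_trans a1.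
have an0 : a != 0 by rewrite gt_eqF.
have [->|an1] := eqVneq a 1.
  by rewrite subrr powRr0 powRr1// mul0r addr0 mulr1 mul1r.
have a10 : 0 < a - 1 by rewrite subr_gt0 lt_neqAle eq_sym an1.
have a1n0 : a - 1 != 0 by rewrite gt_eqF.
have := @conjugate_powR R x (y `^ (a - 1)) a (a / (a - 1)) x0 (powR_ge0 _ _) a0.
rewrite divr_gt0// -powRrM mulrCA divff// mulr1 => /(_ isT) H.
have /H{H} H : a^-1 + (a / (a - 1))^-1 = 1 by field; rewrite an0 a1n0.
rewrite -mulrA -ler_pdivlMl//; apply: (le_trans H); rewrite le_eqVlt; apply/orP; left.
by apply/eqP; field; rewrite an0 a1n0.
Qed.

Lemma powR_tangent_convex a s t : 1 <= a -> 0 <= t -> 0 <= s ->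
  s `^ a - t `^ a <= a * s `^ (a - 1) * (s - t).
Proof.
move=> a1 t0 s0; have := powR_young a1 t0 s0.
have a0 : 0 < a by exact: lt_le_trans a1.
rewrite -(mulr_powRB1 s0 a0); lra.
Qed.

Lemma powR_tangent_concave q s t : 0 < q <= 1 -> 0 <= t -> t <= s ->
  q * s `^ (q - 1) * (s - t) <= s `^ q - t `^ q.
Proof.
move=> /andP[q0 q1] t0 ts; have s0 := le_trans t0 ts.
have qn0 : q != 0 by rewrite gt_eqF.
have [s00|sn0] := eqVneq s 0.
  by have -> : t = s; [apply/le_anti; rewrite ts s00|rewrite !subrr mulr0].
have sp : 0 < s by rewrite lt_neqAle eq_sym sn0.
(* With exponent [1/q] this bounds [q^-1 * t^q * s^(1-q)]; multiplying by [s^(q-1)] leaves a bound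
   on [t^q] alone. *)
have := @powR_young q^-1 (t `^ q) (s `^ q).
rewrite invf_ge1// powR_ge0 powR_ge0 => /(_ q1 isT isT).
rewrite -!powRrM mulfV// !powRr1// mulrBr mulr1 mulfV// => H.
have spq : 0 < s `^ (q - 1) by rewrite powR_gt0.
have E : s `^ (1 - q) * s `^ (q - 1) = 1.
  by rewrite -opprB powRN mulVf// gt_eqF.
have := ler_wpM2r (ltW spq) H.
have -> : q^-1 * t `^ q * s `^ (1 - q) * s `^ (q - 1) = q^-1 * t `^ q.
  by rewrite -mulrA E mulr1.
move=> /(ler_wpM2l (ltW q0)); rewrite mulVKf// -(mulr_powRB1 s0 q0).
have -> : q * ((t + (q^-1 - 1) * s) * s `^ (q - 1)) =
  (q * t + (1 - q) * s) * s `^ (q - 1) by field.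
lra.
Qed.

(** Trades an increment of the [p]-th power of a running maximum for one of its [(p-1)]-th power
    times the new value, as Doob's maximal inequality requires. *)
Lemma powR_increment p s t : 1 < p -> 0 <= t -> 0 <= s ->
  s `^ p - t `^ p <= p / (p - 1) * (s `^ (p - 1) - t `^ (p - 1)) * s.
Proof.
move=> p1 t0 s0; have p10 : 0 < p - 1 by rewrite subr_gt0.
have p0 : 0 < p by lra.
rewrite -(ler_pM2l p10).
have -> : (p - 1) * (p / (p - 1) * (s `^ (p - 1) - t `^ (p - 1)) * s) =
  p * (s * s `^ (p - 1)) - p * s * t `^ (p - 1).
  by field; rewrite gt_eqF.
rewrite (mulr_powRB1 s0 p0); have := powR_young (ltW p1) s0 t0; lra.
Qed.

(** The [p]-th power of the hypothesis reads [x^p <= k^p * y * x^(p-1)], and [x^(p-1)] cancels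
    because [x] is finite. This is one reason for working with finite families. *)
Lemma powR_absorb p k x y : 1 < p -> 0 <= k -> 0 <= x -> 0 <= y ->
  x <= k * y `^ p^-1 * x `^ (1 - p^-1) -> x <= k `^ p * y.
Proof.
move=> p1 k0 x0 y0 H; have p0 : 0 < p by exact: lt_trans p1.
have pn0 : p != 0 by rewrite gt_eqF.
have [->|xn0] := eqVneq x 0; first by rewrite mulr_ge0// powR_ge0.
have xp : 0 < x by rewrite lt_neqAle eq_sym xn0.
have := powR_le (ltW p0) x0 H.
rewrite !powRM ?mulr_ge0 ?powR_ge0// -!powRrM mulVf// powRr1//.
have -> : (1 - p^-1) * p = p - 1 by field.
by rewrite -(mulr_powRB1 x0 p0) ler_pM2r// powR_gt0.
Qed.

End powR_inequalities.

(** * Integral inequalities *)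

Section integral_inequalities.
Context d (T : measurableType d) (R : realType).
Variable mu : {measure set T -> \bar R}.
Local Open Scope ereal_scope.

(* Unlike [ge0_le_integral], no measurability is needed: the integral of a
   nonnegative function is a supremum over the simple functions below it. *)
Lemma le_integral_nonneg (f g : T -> \bar R) : (forall x, 0 <= f x) ->
  (forall x, f x <= g x) -> \int[mu]_x f x <= \int[mu]_x g x.
Proof.
move=> f0 fg; rewrite !ge0_integralTE//; last first.
  by move=> x; exact: le_trans (fg x).
apply: le_ereal_sup => _ [h /= hf <-]; exists h => //= x.
exact: le_trans (fg x).
Qed.

Lemma poweR_le (q : R) (x y : \bar R) : (0 <= q)%R -> 0 <= x -> x <= y ->
  x `^ q <= y `^ q.
Proof.
move=> q0 x0 xy; apply: gt0_ler_poweR => //; rewrite in_itv/= ?leey ?andbT//.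
exact: le_trans xy.
Qed.

(** Hölder's inequality for [u^t] and [v^(1-t)] with exponents [1/t] and [1/(1-t)]. The endpoint
    [t = 1] is included because it occurs when [q = 1]. *)
Lemma holder_interpolation (u v : T -> R) (t : R) : (0 < t <= 1)%R ->
  measurable_fun setT u -> measurable_fun setT v ->
  (forall x, 0 <= u x)%R -> (forall x, 0 <= v x)%R ->
  \int[mu]_x (u x `^ t * v x `^ (1 - t))%:E <=
    (\int[mu]_x (u x)%:E) `^ t * (\int[mu]_x (v x)%:E) `^ (1 - t).
Proof.
move=> /andP[t0 t1] mu_ mv u0 v0.
have iu0 : 0 <= \int[mu]_x (u x)%:E by apply: integral_ge0 => x _; rewrite lee_fin.
have [->|tn1] := eqVneq t 1%R.
  rewrite subrr poweRe0 mule1 poweRe1//; apply: le_integral_nonneg => x.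
    by rewrite lee_fin powRr0 mulr1 powR_ge0.
  by rewrite lee_fin powRr0 mulr1 powRr1.
have t10 : (0 < 1 - t)%R by rewrite subr_gt0 lt_neqAle tn1.
have mp (w : T -> R) (r : R) : measurable_fun setT w ->
    measurable_fun setT (fun x => w x `^ r)%R.
  by move=> mw; apply: (measurableT_comp (measurable_powR r)).
have := @hoelder _ _ _ mu _ _ (t^-1) ((1 - t)^-1) (mp _ t mu_) (mp _ (1 - t)%R mv).
rewrite !invr_gt0 !invrK => /(_ t0 t10).
rewrite subrKC => /(_ erefl); rewrite Lnorm1.
have E (w : T -> R) (r : R) : (0 < r)%R -> (forall x, 0 <= w x)%R ->
    'N[mu]_((r^-1)%:E)[EFin \o (fun x => w x `^ r)%R] =
    (\int[mu]_x (w x)%:E) `^ r.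
  move=> r0 w0; rewrite unlock invrK; congr (_ `^ r).
  apply: eq_integral => x _.
  rewrite /= ger0_norm ?powR_ge0// -powRrM mulfV ?gt_eqF//.
  by rewrite powRr1.
rewrite (E u t t0 u0) (E v _ t10 v0) => H; apply: le_trans H.
rewrite le_eqVlt; apply/orP; left; apply/eqP.
by apply: eq_integral => x _; rewrite /= ger0_norm// mulr_ge0 ?powR_ge0.
Qed.

Lemma integral_step (n : nat) (Q : nat -> set T) (b t : nat -> R) :
  (forall i, measurable (Q i)) -> (forall i, 0 <= b i)%R ->
  (forall i, (i < n)%N -> mu (Q i) = (t i)%:E) ->
  \int[mu]_x (\sum_(i < n) b i * \1_(Q i) x)%:E = (\sum_(i < n) b i * t i)%:E.
Proof.
move=> mQ b0 tE; under eq_integral => x _ do rewrite -sumEFin.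
rewrite ge0_integral_sum//; last 2 first.
- move=> i; apply/measurable_EFinP; apply: measurable_funM => //.
- by move=> i x _; rewrite lee_fin mulr_ge0.
rewrite -sumEFin; apply: eq_bigr => i _.
under eq_integral => x _ do rewrite EFinM.
rewrite ge0_integralZl_EFin//; last exact/measurable_EFinP.
by rewrite integral_indic// setIT tE.
Qed.

End integral_inequalities.

(** * Nested families of sets *)

Section nested_families.
Context (T : Type) (R : realType).
Implicit Types (Q : nat -> set T) (a b m t : nat -> R) (x : T).

Definition nested Q := forall i j, (i < j)%N ->
  Q j `<=` Q i \/ Q i `&` Q j = set0.

(** The constant value on [Q j] of the partial sum over [i < j]; adding [b j] gives the [S_j] of the
    overview. *)
Definition sum_before Q b j : R := \sum_(i < j | `[< Q j `<=` Q i >]) b i.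

Definition sum_upto Q b j : R := sum_before Q b j + b j.

Definition incr Q q b j : R := sum_upto Q b j `^ q - sum_before Q b j `^ q.

(* With t_j = mu (Q j), the mu-integral of (sum_j b_j 1_(Q j))^q:
   see [integral_powR_step]. *)
Definition energy Q t q b n : R := \sum_(j < n) incr Q q b j * t j.

Lemma sum_before_ge0 Q b j : (forall i, 0 <= b i) -> 0 <= sum_before Q b j.
Proof. by move=> b0; exact: sumr_ge0. Qed.

Lemma sum_upto_ge0 Q b j : (forall i, 0 <= b i) -> 0 <= sum_upto Q b j.
Proof. by move=> b0; rewrite addr_ge0// sum_before_ge0. Qed.

Lemma incr_ge0 Q q b j : 0 <= q -> (forall i, 0 <= b i) -> 0 <= incr Q q b j.
Proof.
by move=> q0 b0; rewrite subr_ge0 powR_le// ?sum_before_ge0// lerDl.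
Qed.

Lemma energy_ge0 Q t q b n : 0 <= q -> (forall i, 0 <= b i) ->
  (forall i, 0 <= t i) -> 0 <= energy Q t q b n.
Proof. by move=> q0 b0 t0; apply: sumr_ge0 => i _; rewrite mulr_ge0// incr_ge0. Qed.

(** The point [x] excludes disjointness as soon as it lies in [Q i]. Hence the indicator of an
    earlier set is constant on [Q j]. *)
Lemma nested_mem Q i j x : nested Q -> (i < j)%N -> Q j x ->
  (x \in Q i) = `[< Q j `<=` Q i >].
Proof.
move=> nQ ij Qjx; apply/idP/asboolP => [|sub]; last by rewrite inE; exact: sub.
rewrite inE => Qix; have [//|QQ0] := nQ _ _ ij.
by have : (Q i `&` Q j) x by []; rewrite QQ0.
Qed.

Lemma partial_sum_on Q b j x : nested Q -> Q j x ->
  \sum_(i < j) b i * \1_(Q i) x = sum_before Q b j.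
Proof.
move=> nQ Qjx; rewrite /sum_before [RHS]big_mkcond/=; apply: eq_bigr => i _.
rewrite indicE (nested_mem nQ (ltn_ord i) Qjx).
by case: ifP => _; rewrite ?mulr1 ?mulr0.
Qed.

Lemma partial_sumS_on Q b j x : nested Q -> Q j x ->
  \sum_(i < j.+1) b i * \1_(Q i) x = sum_upto Q b j.
Proof.
by move=> nQ Qjx; rewrite big_ord_recr/= partial_sum_on// indicE mem_set// mulr1.
Qed.

(** The running quantity [u] changes only at steps [j] with [x] in [Q j], and its values before and
    after such a step do not depend on [x]. It serves both for partial sums and for running
    maxima. *)
Lemma telescope_on (phi : R -> R) Q (u v v' : nat -> R) n x :
  phi (u 0%N) = 0 ->
  (forall j, Q j x -> u j = v' j /\ u j.+1 = v j) ->
  (forall j, ~ Q j x -> u j.+1 = u j) ->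
  phi (u n) = \sum_(j < n) (phi (v j) - phi (v' j)) * \1_(Q j) x.
Proof.
move=> phi0 uin uout; elim: n => [|n IH]; first by rewrite big_ord0.
rewrite big_ord_recr/= -IH indicE; have [Qnx|Qnx] := pselect (Q n x).
  by have [-> ->] := uin _ Qnx; rewrite mem_set// mulr1 subrKC.
by rewrite uout// memNset// mulr0 addr0.
Qed.

Lemma powR_sum_telescope Q q b n x : nested Q -> 0 < q ->
  (\sum_(i < n) b i * \1_(Q i) x) `^ q = \sum_(j < n) incr Q q b j * \1_(Q j) x.
Proof.
move=> nQ q0.
apply: (@telescope_on (fun y => y `^ q) Q (fun n => \sum_(i < n) b i * \1_(Q i) x)).
- by rewrite big_ord0 powR0// gt_eqF.
- by move=> j Qjx; rewrite partial_sum_on// partial_sumS_on.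
- by move=> j Qjx; rewrite big_ord_recr/= indicE memNset// mulr0 addr0.
Qed.

(** Finite counterpart of the localized supremum in [Ainfty_char], with [m i] in place of the ratio
    of the measures of [Q i]. *)
Definition max_below Q m n j x : R :=
  \big[Num.max/0]_(i < n | `[< Q i `<=` Q j >]) (m i * \1_(Q i) x).

Lemma max_below_ge0 Q m n j x : 0 <= max_below Q m n j x.
Proof. exact: bigmax_ge_id. Qed.

(** By telescoping, [S_i^q] is the sum of the increments over those [j <= i] with [x] in [Q j]. Each
    such [Q j] contains [Q i], so [m i] competes in the maximum at [j]; all other terms are
    nonnegative. *)
Lemma powR_sum_upto_le Q q b m n i x : nested Q -> 0 < q ->
  (forall i, 0 <= b i) -> (forall i, 0 <= m i) -> (i < n)%N -> Q i x ->
  sum_upto Q b i `^ q * m i <= \sum_(j < n) incr Q q b j * max_below Q m n j x.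
Proof.
move=> nQ q0 b0 m0 ni Qix.
rewrite -(partial_sumS_on b nQ Qix) powR_sum_telescope// mulr_suml.
rewrite (big_ord_widen n (fun j => incr Q q b j * \1_(Q j) x * m i)) // big_mkcond/=.
apply: ler_sum => j _; have inc0 := incr_ge0 Q j (ltW q0) b0.
case: ifPn => [ji|_]; last by rewrite mulr_ge0// max_below_ge0.
rewrite -mulrA ler_wpM2l// indicE.
have [Qjx|] := boolP (x \in Q j); last by rewrite mul0r max_below_ge0.
rewrite mul1r.
have sub : `[< Q i `<=` Q j >].
  move: ji; rewrite ltnS leq_eqVlt => /orP[/eqP <-|ji]; first exact/asboolP.
  by rewrite -(nested_mem nQ ji Qix).
rewrite /max_below; apply: (@bigmax_sup _ _ _ 0 (Ordinal ni)) => //=.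
by rewrite indicE mem_set// mulr1.
Qed.

End nested_families.

(** * Exchanging the measures *)

Section transfer.
Context d (T : measurableType d) (R : realType).
Implicit Types (mu sigma omega : {measure set T -> \bar R}).
Variables (Q : nat -> set T) (n : nat).
Hypotheses (mQ : forall i, measurable (Q i)) (nQ : nested Q).
Implicit Types (a b m s w t : nat -> R) (q C : R).

Lemma measurable_step b :
  measurable_fun setT (fun x => \sum_(i < n) b i * \1_(Q i) x).
Proof.
by apply: measurable_sum => i; apply: measurable_funM.
Qed.

Lemma measurable_max_below m j : measurable_fun setT (max_below Q m n j).
Proof.
rewrite /max_below; elim: (index_enum _) => [|i r IH].
  by under eq_fun do rewrite big_nil; exact: measurable_cst.
under eq_fun do rewrite big_cons.
have [_|_] := boolP `[< Q i `<=` Q j >]; last exact: IH.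
apply: measurable_maxr; last exact: IH.
exact: measurable_funM.
Qed.

Lemma integral_powR_step mu t q b : 0 < q -> (forall i, 0 <= b i) ->
  (forall i, (i < n)%N -> mu (Q i) = (t i)%:E) ->
  (\int[mu]_x ((\sum_(i < n) b i * \1_(Q i) x) `^ q)%:E =
   (energy Q t q b n)%:E)%E.
Proof.
move=> q0 b0 tE; under eq_integral => x _ do rewrite powR_sum_telescope//.
by apply: integral_step => // i; apply: incr_ge0 => //; exact: ltW.
Qed.

(** The Fujii-Wilson condition restricted to the family, with [t j] for the measure on its
    right-hand side. *)
Definition carleson mu m t C := forall j, (j < n)%N ->
  (\int[mu]_x (max_below Q m n j x)%:E <= (C * t j)%:E)%E.

Lemma integral_max_below_le mu m t q b C : 0 < q -> (forall i, 0 <= b i) ->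
  carleson mu m t C ->
  (\int[mu]_x (\sum_(j < n) incr Q q b j * max_below Q m n j x)%:E <=
   (C * energy Q t q b n)%:E)%E.
Proof.
move=> q0 b0 H; under eq_integral => x _ do rewrite -sumEFin.
have i0 j : 0 <= incr Q q b j by apply: incr_ge0 => //; exact: ltW.
rewrite ge0_integral_sum//; last 2 first.
- move=> i; apply/measurable_EFinP; apply: measurable_funM => //.
  exact: measurable_max_below.
- by move=> i x _; rewrite lee_fin mulr_ge0// max_below_ge0.
rewrite mulr_sumr -sumEFin; apply: lee_sum => i _.
under eq_integral => x _ do rewrite EFinM.
rewrite ge0_integralZl_EFin//; last 2 first.
- by move=> x _; rewrite lee_fin max_below_ge0.
- by apply/measurable_EFinP; exact: measurable_max_below.
by rewrite mulrCA EFinM lee_wpmul2l ?lee_fin// H.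
Qed.

Section two_measures.
Variables (sigma omega : {measure set T -> \bar R}) (s w : nat -> R).
Hypotheses (s_ge0 : forall i, 0 <= s i) (w_ge0 : forall i, 0 <= w i).
Hypotheses (s_gt0 : forall i, (i < n)%N -> 0 < s i)
           (w_gt0 : forall i, (i < n)%N -> 0 < w i).
Hypotheses (sE : forall i, (i < n)%N -> sigma (Q i) = (s i)%:E)
           (wE : forall i, (i < n)%N -> omega (Q i) = (w i)%:E).

(** Hölder bounds the left-hand side by [(q^-1 * E)^q * (C * E)^(1-q)]: the first factor comes from
    the concave tangent estimate, the second from the Carleson condition. The powers of [E] add up
    to one. *)
Lemma energy_transfer_le1 q C a : 0 < q <= 1 -> 0 <= C ->
  (forall i, 0 <= a i) -> carleson omega (fun i => s i / w i) s C ->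
  energy Q w q a n <= q `^ (- q) * C `^ (1 - q) *
    energy Q s q (fun i => a i * (w i / s i) `^ (1 / q)) n.
Proof.
move=> /andP[q0 q1] C0 a0 HC; have qn0 : q != 0 by rewrite gt_eqF.
set b := fun i => _; set m := fun i => s i / w i.
have m0 i : 0 <= m i by rewrite divr_ge0.
have b0 i : 0 <= b i by rewrite mulr_ge0 ?powR_ge0.
set E := energy Q s q b n; have E0 : 0 <= E by apply: energy_ge0 => //; exact: ltW.
(* The factor [m i] converts the [omega]-measure of [Q i] into its [sigma]-measure, so that the
   [omega]-integral of [u] is controlled by [E]. *)
pose c i := b i * sum_upto Q b i `^ (q - 1) * m i.
have c0 i : 0 <= c i by rewrite mulr_ge0// mulr_ge0// powR_ge0.
pose u x := \sum_(i < n) c i * \1_(Q i) x.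
pose v x := \sum_(j < n) incr Q q b j * max_below Q m n j x.
have u0 x : 0 <= u x by apply: sumr_ge0 => i _; rewrite mulr_ge0.
have v0 x : 0 <= v x.
  by apply: sumr_ge0 => i _; rewrite mulr_ge0// ?max_below_ge0// incr_ge0// ltW.
have pointwise x : \sum_(i < n) a i * \1_(Q i) x <= u x * v x `^ ((1 - q) / q).
  rewrite mulr_suml; apply: ler_sum => i _.
  have [Qix|Qix] := pselect (Q i x); last first.
    by rewrite indicE memNset// !mulr0 mul0r.
  (* Zero coefficients are split off so that [sum_upto Q b i] is positive; only then do its powers
     [q - 1] and [1 - q] cancel. *)
  rewrite indicE mem_set// !mulr1; have [->|an0] := eqVneq (a i) 0.
    by rewrite mulr_ge0 ?powR_ge0.
  have ai : 0 < a i by rewrite lt_neqAle eq_sym an0 a0.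
  have mi : 0 < m i by rewrite divr_gt0// ?s_gt0 ?w_gt0.
  have aE : a i = b i * m i `^ (1 / q).
    rewrite /b -mulrA -powRM ?divr_ge0//.
    rewrite (_ : w i / s i * m i = 1) ?powR1 ?mulr1// /m.
    by field; rewrite !gt_eqF ?s_gt0 ?w_gt0.
  have bi : 0 < b i by rewrite mulr_gt0// powR_gt0// divr_gt0// ?s_gt0 ?w_gt0.
  have Si : 0 < sum_upto Q b i by rewrite ltr_wpDl// sum_before_ge0.
  have H := powR_sum_upto_le nQ q0 b0 m0 (ltn_ord i) Qix.
  have : (sum_upto Q b i `^ q * m i) `^ ((1 - q) / q) <= v x `^ ((1 - q) / q).
    apply: powR_le => //; first by rewrite divr_ge0 ?subr_ge0// ltW.
    by rewrite mulr_ge0 ?powR_ge0.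
  move=> /(ler_wpM2l (c0 i)); apply: le_trans.
  rewrite powRM ?powR_ge0// -powRrM.
  have -> : q * ((1 - q) / q) = 1 - q by field.
  rewrite le_eqVlt; apply/orP; left; apply/eqP; rewrite aE /c.
  have -> : 1 / q = 1 + (1 - q) / q by field.
  rewrite (@powRD _ (m i) 1) ?(gt_eqF mi) ?implybT// (powRr1 (ltW mi)).
  rewrite -[1 - q]opprB.
  rewrite powRN; field; rewrite gt_eqF// powR_gt0//.
have intu : (\int[omega]_x (u x)%:E <= (q^-1 * E)%:E)%E.
  rewrite /u (integral_step mQ c0 wE) lee_fin mulr_sumr ler_sum// => i _.
  have -> : c i * w i = b i * sum_upto Q b i `^ (q - 1) * s i.
    by rewrite /c /m; field; rewrite gt_eqF// w_gt0.
  rewrite mulrA ler_wpM2r// -ler_pdivrMl ?invr_gt0// invrK.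
  have := @powR_tangent_concave R q (sum_upto Q b i) (sum_before Q b i).
  rewrite q0 q1 sum_before_ge0// lerDl b0 => /(_ isT isT isT).
  by rewrite [X in _ * X]addrAC subrr add0r -mulrA [X in _ * X]mulrC.
have intv := integral_max_below_le q0 b0 HC.
rewrite -lee_fin -(integral_powR_step q0 a0 wE).
apply: (@le_trans _ _ (\int[omega]_x (u x `^ q * v x `^ (1 - q))%:E)%E).
  apply: le_integral_nonneg => x; rewrite lee_fin ?powR_ge0//.
  rewrite -[1 - q](divfK qn0) powRrM -powRM ?powR_ge0//.
  by apply: powR_le => //; [exact: ltW|apply: sumr_ge0 => i _; rewrite mulr_ge0].
have mu_ : measurable_fun setT u by exact: measurable_step.
have mv : measurable_fun setT v.
  apply: measurable_sum => j; apply: measurable_funM => //.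
  exact: measurable_max_below.
have q01 : 0 < q <= 1 by rewrite q0.
apply: (le_trans (holder_interpolation omega q01 mu_ mv u0 v0)).
apply: (@le_trans _ _ (((q^-1 * E) `^ q)%:E * ((C * E) `^ (1 - q))%:E)%E).
  apply: lee_pmul; rewrite ?poweR_ge0// -poweR_EFin.
    apply: poweR_le => //; first exact: ltW.
    by apply: integral_ge0 => x _; rewrite lee_fin.
  apply: poweR_le => //; first by rewrite subr_ge0.
  by apply: integral_ge0 => x _; rewrite lee_fin.
have q0' := ltW q0; rewrite -EFinM lee_fin !powRM ?invr_ge0//.
have [->|En0] := eqVneq E 0; first by rewrite powR0// !mulr0 mul0r.
have -> : q^-1 `^ q = q `^ (- q) by rewrite -powR_inv1 ?ltW// -powRrM mulN1r.
rewrite mulrACA -powRD ?En0 ?implybT//.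
by rewrite subrKC powRr1.
Qed.

(** Here [v] is built from [a] itself, so Hölder yields [F <= q * E^(1/q) * (C * F)^(1-1/q)] with
    the energy [F] of [a] on both sides; absorbing it gives the constant. *)
Lemma energy_transfer_gt1 q C a : 1 < q -> 0 <= C ->
  (forall i, 0 <= a i) -> carleson sigma (fun i => w i / s i) w C ->
  energy Q w q a n <= q `^ q * C `^ (q - 1) *
    energy Q s q (fun i => a i * (w i / s i) `^ (1 / q)) n.
Proof.
move=> q1 C0 a0 HC; have q0 : 0 < q by exact: lt_trans q1.
have qn0 : q != 0 by rewrite gt_eqF.
set b := fun i => _; set m := fun i => w i / s i.
have m0 i : 0 <= m i by rewrite divr_ge0.
have b0 i : 0 <= b i by rewrite mulr_ge0 ?powR_ge0.
set E := energy Q s q b n; have E0 : 0 <= E by apply: energy_ge0 => //; exact: ltW.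
set F := energy Q w q a n; have F0 : 0 <= F by apply: energy_ge0 => //; exact: ltW.
pose c i := a i * sum_upto Q a i `^ (q - 1) * m i.
have c0 i : 0 <= c i by rewrite mulr_ge0// mulr_ge0// powR_ge0.
pose g x := \sum_(i < n) b i * \1_(Q i) x.
pose v x := \sum_(j < n) incr Q q a j * max_below Q m n j x.
have g0 x : 0 <= g x by apply: sumr_ge0 => i _; rewrite mulr_ge0.
have v0 x : 0 <= v x.
  by apply: sumr_ge0 => i _; rewrite mulr_ge0// ?max_below_ge0// incr_ge0// ltW.
have pointwise x : \sum_(i < n) c i * \1_(Q i) x <=
    (g x `^ q) `^ q^-1 * v x `^ (1 - q^-1).
  rewrite -powRrM mulfV// powRr1// mulr_suml; apply: ler_sum => i _.
  have [Qix|Qix] := pselect (Q i x); last first.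
    by rewrite indicE memNset// !mulr0 mul0r.
  rewrite indicE mem_set// !mulr1.
  have mi : 0 < m i by rewrite divr_gt0// ?s_gt0 ?w_gt0.
  have H := powR_sum_upto_le nQ q0 a0 m0 (ltn_ord i) Qix.
  have : (sum_upto Q a i `^ q * m i) `^ (1 - q^-1) <= v x `^ (1 - q^-1).
    apply: powR_le => //; first by rewrite subr_ge0 invf_le1// ltW.
    by rewrite mulr_ge0 ?powR_ge0.
  move=> /(ler_wpM2l (b0 i)); apply: le_trans.
  rewrite powRM ?powR_ge0// -powRrM.
  have -> : q * (1 - q^-1) = q - 1 by field.
  rewrite le_eqVlt; apply/orP; left; apply/eqP; rewrite /c /b -/(m i) div1r.
  (* One factor is the weight contained in [b i], the other comes from [powR_sum_upto_le]. *)
  have mE : m i = m i `^ q^-1 * m i `^ (1 - q^-1).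
    by rewrite -powRD ?(gt_eqF mi) ?implybT// subrKC powRr1.
  by rewrite [X in _ * X = _]mE; ring.
have FE : (F%:E <= (q%:E * \int[sigma]_x (\sum_(i < n) c i * \1_(Q i) x)%:E))%E.
  rewrite (integral_step mQ c0 sE) -EFinM lee_fin mulr_sumr ler_sum// => i _.
  have -> : c i * s i = a i * sum_upto Q a i `^ (q - 1) * w i.
    by rewrite /c /m; field; rewrite gt_eqF// s_gt0.
  rewrite mulrA ler_wpM2r//.
  have := @powR_tangent_convex R q (sum_upto Q a i) (sum_before Q a i) (ltW q1).
  rewrite sum_before_ge0// sum_upto_ge0// => /(_ isT isT).
  by rewrite [X in _ * X]addrAC subrr add0r -mulrA [X in _ * X]mulrC.
have intv := integral_max_below_le q0 a0 HC.
have mg : measurable_fun setT g by exact: measurable_step.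
have mgq : measurable_fun setT (fun x => g x `^ q).
  exact: (measurableT_comp (measurable_powR q)).
have mv : measurable_fun setT v.
  apply: measurable_sum => j; apply: measurable_funM => //.
  exact: measurable_max_below.
have q01 : 0 < q^-1 <= 1 by rewrite invr_gt0 q0 invf_le1// ltW.
have gq0 x : 0 <= g x `^ q by exact: powR_ge0.
have : (F%:E <= (q * (E `^ q^-1 * (C * F) `^ (1 - q^-1)))%:E)%E.
  apply: (le_trans FE); rewrite EFinM lee_pmul2l//.
  apply: (@le_trans _ _ (\int[sigma]_x
      ((g x `^ q) `^ q^-1 * v x `^ (1 - q^-1))%:E)%E).
    apply: le_integral_nonneg => x; rewrite lee_fin//.
    by apply: sumr_ge0 => i _; rewrite mulr_ge0.
  apply: (le_trans (holder_interpolation sigma q01 mgq mv gq0 v0)).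
  rewrite /g (integral_powR_step q0 b0 sE) EFinM -!poweR_EFin.
  apply: lee_pmul; rewrite ?poweR_ge0//.
  apply: poweR_le => //; first by rewrite subr_ge0 invf_le1// ltW.
  by apply: integral_ge0 => x _; rewrite lee_fin.
rewrite lee_fin powRM// => H.
have -> : q `^ q * C `^ (q - 1) = (q * C `^ (1 - q^-1)) `^ q.
  rewrite powRM ?powR_ge0// ?(ltW q0)// -powRrM.
  by have -> : (1 - q^-1) * q = q - 1 by field.
apply: powR_absorb => //; first by rewrite mulr_ge0 ?powR_ge0// ltW.
apply: (le_trans H); rewrite le_eqVlt; apply/orP; left; apply/eqP; ring.
Qed.

End two_measures.
End transfer.

(** * One weight: the maximal function and the test function *)

Section running_maximum.
Context (R : realType).
Implicit Types (a : nat -> R) (P : pred nat).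

(** The recursion exposes the last step, which is the form that [telescope_on] needs. *)
Fixpoint running_max a P n : R :=
  if n is k.+1 then
    if P k then Num.max (running_max a P k) (a k) else running_max a P k
  else 0.

Lemma running_max_ge0 a P n : 0 <= running_max a P n.
Proof. by elim: n => //= n IH; case: ifP => // _; rewrite le_max IH. Qed.

Lemma eq_running_max a P P' n : (forall i, (i < n)%N -> P i = P' i) ->
  running_max a P n = running_max a P' n.
Proof.
elim: n => //= n IH PP'; rewrite (PP' n)// IH// => i ni.
by rewrite PP'// ltnW.
Qed.

Lemma running_max_ge a P n i : (i < n)%N -> P i -> a i <= running_max a P n.
Proof.
elim: n => //= n IH; rewrite ltnS leq_eqVlt => /orP[/eqP <- ->|ni Pi].
  by rewrite le_max lexx orbT.
by case: ifP => _; rewrite ?le_max IH.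
Qed.

End running_maximum.

Section one_weight.
Context d (T : measurableType d) (R : realType).
Variables (Q : nat -> set T) (n : nat).
Hypotheses (mQ : forall i, measurable (Q i)) (nQ : nested Q).
Variables (sigma : {measure set T -> \bar R}) (s : nat -> R).
Hypotheses (s_ge0 : forall i, 0 <= s i) (s_gt0 : forall i, (i < n)%N -> 0 < s i).
Hypothesis (sE : forall i, (i < n)%N -> sigma (Q i) = (s i)%:E).
Variables (p : R).
Hypothesis p_gt1 : 1 < p.

Section maximal.
Variables (h : T -> R) (A : nat -> R) (N : R).
Hypotheses (mh : measurable_fun setT h) (h_ge0 : forall x, 0 <= h x).
Hypothesis hN : (\int[sigma]_x (h x `^ p)%:E = N%:E)%E.
Hypothesis hA :
  forall i, (i < n)%N -> (\int[sigma]_(x in Q i) (h x)%:E = (A i)%:E)%E.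
Hypothesis A_ge0 : forall i, 0 <= A i.

Let a i := A i / s i.

(** The dyadic maximal function of [h] over the finite family: under the section hypotheses [a i] is
    the [sigma]-average of [h] on [Q i]. *)
Definition maximal x : R := running_max a (fun i => x \in Q i) n.

Let max_before j := running_max a (fun i => `[< Q j `<=` Q i >]) j.
Let max_upto j := Num.max (max_before j) (a j).

(** On [Q j] the running maximum over earlier sets is constant by nestedness, so maxima telescope
    just as sums do. *)
Let powR_maximal r x : 0 < r -> maximal x `^ r =
  \sum_(j < n) (max_upto j `^ r - max_before j `^ r) * \1_(Q j) x.
Proof.
move=> r0; apply: (@telescope_on _ _ (fun y => y `^ r) Q
  (fun n => running_max a (fun i => x \in Q i) n)).
- by rewrite /= powR0// gt_eqF.
- move=> j Qjx; have E : running_max a (fun i => x \in Q i) j = max_before j.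
    by apply: eq_running_max => i ij; exact: nested_mem.
  by rewrite /= mem_set// E.
- by move=> j Qjx; rewrite /= memNset.
Qed.

Let max_incr_ge0 r j : 0 <= r -> 0 <= max_upto j `^ r - max_before j `^ r.
Proof.
by move=> r0; rewrite subr_ge0 powR_le// ?running_max_ge0// le_max lexx.
Qed.

Lemma measurable_maximal : measurable_fun setT maximal.
Proof.
(* At exponent one the telescoped form exhibits a step function. *)
have -> : maximal = fun x => \sum_(j < n)
    (max_upto j `^ 1 - max_before j `^ 1) * \1_(Q j) x.
  apply/funext => x; rewrite -(powRr1 (_ : 0 <= maximal x)) ?powR_maximal//.
  exact: running_max_ge0.
exact: (measurable_step n mQ (fun j => max_upto j `^ 1 - max_before j `^ 1)).
Qed.

(** Doob's argument: comparing increments gives [X <= p / (p - 1) * \int h M^(p-1)], where [M] is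
    the maximal function and [X] the integral of [M^p]. Hölder then yields a bound with [X^(1-1/p)],
    which is absorbed. *)
Lemma maximal_strong_type :
  (\int[sigma]_x (maximal x `^ p)%:E <= ((p / (p - 1)) `^ p * N)%:E)%E.
Proof.
have p0 : 0 < p by exact: lt_trans p_gt1.
have p10 : 0 < p - 1 by rewrite subr_gt0.
have pn0 : p != 0 by rewrite gt_eqF.
have M0 x : 0 <= maximal x by exact: running_max_ge0.
have N0 : 0 <= N.
  by rewrite -lee_fin -hN integral_ge0// => x _; rewrite lee_fin powR_ge0.
pose X := \sum_(j < n) (max_upto j `^ p - max_before j `^ p) * s j.
have XE : (\int[sigma]_x (maximal x `^ p)%:E = X%:E)%E.
  under eq_integral => x _ do rewrite powR_maximal//.
  apply: (@integral_step _ _ _ _ n Q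
    (fun j => max_upto j `^ p - max_before j `^ p)) => // i.
  by apply: max_incr_ge0; exact: ltW.
have X0 : 0 <= X by apply: sumr_ge0 => i _; rewrite mulr_ge0// max_incr_ge0// ltW.
rewrite XE lee_fin; apply: powR_absorb => //; first by rewrite divr_ge0// ltW.
have step1 : X <= p / (p - 1) *
    \sum_(j < n) (max_upto j `^ (p - 1) - max_before j `^ (p - 1)) * A j.
  rewrite mulr_sumr; apply: ler_sum => j _.
  have si := s_gt0 (ltn_ord j).
  (* where the running maximum jumps, its new value is the average a j *)
  rewrite /max_upto; case: (leP (a j) (max_before j)) => [_|aj].
    by rewrite !subrr !mul0r mulr0.
  have mb0 : 0 <= max_before j by exact: running_max_ge0.
  have AE : A j = a j * s j by rewrite /a divfK// gt_eqF.
  rewrite (_ : _ * (_ * A j) = p / (p - 1) *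
    (a j `^ (p - 1) - max_before j `^ (p - 1)) * a j * s j); last first.
    by rewrite AE; ring.
  by rewrite ler_wpM2r//; apply: powR_increment => //; exact: le_trans (ltW aj).
have step2 : (\sum_(j < n) (max_upto j `^ (p - 1) - max_before j `^ (p - 1)) * A j)%:E
    = (\int[sigma]_x (h x * maximal x `^ (p - 1))%:E)%E.
  under [RHS]eq_integral => x _ do rewrite powR_maximal// mulr_sumr -sumEFin.
  rewrite ge0_integral_sum//; last 2 first.
  - move=> i; apply/measurable_EFinP; apply: measurable_funM => //.
    exact: measurable_funM.
  - by move=> i x _; rewrite lee_fin mulr_ge0// mulr_ge0// max_incr_ge0// ltW.
  rewrite -sumEFin; apply: eq_bigr => j _.
  under eq_integral => x _ do rewrite mulrCA EFinM.
  rewrite ge0_integralZl_EFin//; last 3 first.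
  - by move=> x _; rewrite lee_fin mulr_ge0.
  - by apply/measurable_EFinP; exact: measurable_funM.
  - by apply: max_incr_ge0; exact: ltW.
  rewrite EFinM; congr (_ * _)%E; rewrite -hA// integral_mkcond.
  apply: eq_integral => x _; rewrite /= patchE indicE.
  by case: ifP => _; rewrite ?mulr1 ?mulr0.
rewrite -mulrA; apply: (le_trans step1).
rewrite ler_wpM2l//; first by rewrite divr_ge0// ltW.
rewrite -lee_fin step2.
have mM := measurable_maximal.
have mp (u : T -> R) : measurable_fun setT u ->
    measurable_fun setT (fun x => u x `^ p).
  by move=> mu_; apply: (measurableT_comp (measurable_powR p)).
have p01 : 0 < p^-1 <= 1 by rewrite invr_gt0 p0 invf_le1// ltW.
have up0 (u : T -> R) x : 0 <= u x `^ p by exact: powR_ge0.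
have := holder_interpolation sigma p01 (mp _ mh) (mp _ mM) (up0 h) (up0 maximal).
rewrite hN XE !poweR_EFin -EFinM => H; apply: le_trans H.
rewrite le_eqVlt; apply/orP; left; apply/eqP; apply: eq_integral => x _.
rewrite -!powRrM mulfV// powRr1//.
by have -> : p * (1 - p^-1) = p - 1 by field.
Qed.

(** Each average is at most the maximal function on its cube, which therefore factors out of the
    sum. Hölder with weights [q/p] and [1 - q/p] separates it from [g], and [r * (1 - q/p) = q]. *)
Lemma energy_average_le q (b : nat -> R) : 0 < q -> q < p ->
  (forall i, 0 <= b i) ->
  energy Q s q (fun i => b i * a i) n <=
    ((p / (p - 1)) `^ p * N) `^ (q / p) *
    energy Q s (p * q / (p - q)) b n `^ (1 - q / p).
Proof.
move=> q0 qp b0; have p0 : 0 < p by exact: lt_trans p_gt1.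
have pn0 : p != 0 by rewrite gt_eqF.
have pq0 : 0 < p - q by rewrite subr_gt0.
have pqn0 : p - q != 0 by rewrite gt_eqF.
set r := p * q / (p - q); have r0 : 0 < r by rewrite divr_gt0// mulr_gt0.
have a0 i : 0 <= a i by rewrite divr_ge0.
have ba0 i : 0 <= b i * a i by rewrite mulr_ge0.
have M0 x : 0 <= maximal x by exact: running_max_ge0.
have N0 : 0 <= N.
  by rewrite -lee_fin -hN integral_ge0// => x _; rewrite lee_fin powR_ge0.
pose g x := \sum_(i < n) b i * \1_(Q i) x.
have g0 x : 0 <= g x by apply: sumr_ge0 => i _; rewrite mulr_ge0.
rewrite -lee_fin -(integral_powR_step mQ nQ q0 ba0 sE).
have mM : measurable_fun setT (fun x => maximal x `^ p).
  apply: (measurableT_comp (measurable_powR p)); exact: measurable_maximal.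
have mg : measurable_fun setT (fun x => g x `^ r).
  apply: (measurableT_comp (measurable_powR r)); exact: measurable_step.
have t01 : 0 < q / p <= 1 by rewrite divr_gt0//= ler_pdivrMr// mul1r ltW.
have up0 (u : T -> R) e x : 0 <= u x `^ e by exact: powR_ge0.
apply: (@le_trans _ _ (\int[sigma]_x
    ((maximal x `^ p) `^ (q / p) * (g x `^ r) `^ (1 - q / p))%:E)%E).
  apply: le_integral_nonneg => x; rewrite lee_fin ?powR_ge0//.
  rewrite -!powRrM mulrCA mulfV// mulr1.
  have -> : r * (1 - q / p) = q by rewrite /r; field; rewrite pqn0 pn0.
  rewrite -powRM//; apply: powR_le; first exact: ltW.
    by apply: sumr_ge0 => i _; rewrite mulr_ge0.
  rewrite mulr_sumr; apply: ler_sum => i _.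
  rewrite indicE; have [Qix|_] := boolP (x \in Q i); last by rewrite !mulr0.
  rewrite !mulr1 mulrC ler_wpM2r//.
  exact: (@running_max_ge _ a (fun i => x \in Q i)).
apply: (le_trans (holder_interpolation sigma t01 mM mg (up0 maximal p) (up0 g r))).
rewrite /g (integral_powR_step mQ nQ r0 b0 sE) EFinM -!poweR_EFin.
apply: lee_pmul; rewrite ?poweR_ge0//.
apply: poweR_le; [|by apply: integral_ge0 => x _; rewrite lee_fin powR_ge0|].
  by rewrite divr_ge0 ?(ltW q0) ?(ltW p0).
exact: maximal_strong_type.
Qed.

End maximal.

(** With [al = p / (p - q)], telescoping [g^al] and the convex tangent estimate give [g^al <= al *
    \sum_i b_i (A_i / s_i) 1_(Q i)] pointwise. Taking [q]-th powers suffices, since [r = al * q]. *)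
Lemma energy_test_le q (b A : nat -> R) : 0 < q -> q < p ->
  (forall i, 0 <= b i) ->
  (forall i, (i < n)%N -> (\int[sigma]_(x in Q i)
    (((\sum_(i < n) b i * \1_(Q i) x) `^ (q / (p - q)))%:E) = (A i)%:E)%E) ->
  (forall i, 0 <= A i) ->
  energy Q s (p * q / (p - q)) b n <=
    (p / (p - q)) `^ q * energy Q s q (fun i => b i * (A i / s i)) n.
Proof.
move=> q0 qp b0 hA A0; have p0 : 0 < p by exact: lt_trans p_gt1.
have pn0 : p != 0 by rewrite gt_eqF.
have pq0 : 0 < p - q by rewrite subr_gt0.
have pqn0 : p - q != 0 by rewrite gt_eqF.
set r := p * q / (p - q); have r0 : 0 < r by rewrite divr_gt0// mulr_gt0.
set al := p / (p - q); have al0 : 0 < al by rewrite divr_gt0.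
have al1 : 1 <= al by rewrite ler_pdivlMr// mul1r gerBl ltW.
have alE : al - 1 = q / (p - q) by rewrite /al; field.
pose g x := \sum_(i < n) b i * \1_(Q i) x.
have g0 x : 0 <= g x by apply: sumr_ge0 => i _; rewrite mulr_ge0.
have a0 i : 0 <= A i / s i by rewrite divr_ge0.
have ba0 i : 0 <= b i * (A i / s i) by rewrite mulr_ge0.
(* On [Q i] the full sum [g] dominates [sum_upto Q b i]; averaging the power [al - 1 = q / (p - q)]
   preserves this. *)
have SA i : (i < n)%N -> sum_upto Q b i `^ (al - 1) <= A i / s i.
  move=> ni; rewrite ler_pdivlMr ?s_gt0// -lee_fin -hA// alE EFinM -sE//.
  have -> : ((sum_upto Q b i `^ (q / (p - q)))%:E * sigma (Q i) =
      \int[sigma]_x (sum_upto Q b i `^ (q / (p - q)) * \1_(Q i) x)%:E)%E.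
    under eq_integral do rewrite EFinM.
    rewrite ge0_integralZl_EFin ?powR_ge0//; last exact/measurable_EFinP.
    by rewrite integral_indic// setIT.
  rewrite [leRHS]integral_mkcond; apply: le_integral_nonneg => x.
    by rewrite lee_fin mulr_ge0// powR_ge0.
  rewrite patchE indicE; case: ifPn => Qix; last by rewrite mulr0.
  rewrite mulr1 lee_fin powR_le// ?sum_upto_ge0//.
    by rewrite divr_ge0// ltW.
  rewrite inE in Qix; rewrite -(partial_sumS_on b nQ Qix).
  rewrite (big_ord_widen n (fun j => b j * \1_(Q j) x))// big_mkcond/=.
  by apply: ler_sum => j _; case: ifP => // _; rewrite mulr_ge0.
have alq0 : 0 <= al `^ q by exact: powR_ge0.
rewrite -lee_fin EFinM -(integral_powR_step mQ nQ q0 ba0 sE).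
rewrite -(integral_powR_step mQ nQ r0 b0 sE) -ge0_integralZl_EFin//; last 2 first.
- by move=> x _; rewrite lee_fin powR_ge0.
- apply/measurable_EFinP; apply: (measurableT_comp (measurable_powR q)).
  exact: (measurable_step n mQ (fun i => b i * (A i / s i))).
apply: le_integral_nonneg => x; first by rewrite lee_fin powR_ge0.
have -> : r = al * q by rewrite /r /al; field.
rewrite -EFinM lee_fin powRrM -powRM//; last 2 first.
- exact: ltW.
- by apply: sumr_ge0 => i _; rewrite mulr_ge0.
apply: powR_le; rewrite ?powR_ge0//; first exact: ltW.
rewrite powR_sum_telescope// mulr_sumr; apply: ler_sum => i _.
rewrite mulrA ler_wpM2r//.
have := powR_tangent_convex al1 (sum_before_ge0 Q i b0) (sum_upto_ge0 Q i b0).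
rewrite [X in _ * X]addrAC subrr add0r => H; apply: (le_trans H).
rewrite -mulrA ler_wpM2l ?(ltW al0)// mulrC ler_wpM2l//.
exact: SA.
Qed.

End one_weight.

(** * Countable families *)

Section countable_families.
Context d (T : measurableType d) (R : realType).
Variable mu : {measure set T -> \bar R}.
Local Open Scope ereal_scope.

Lemma null_bigcup (D : set (set T)) : countable D ->
  (forall Q, D Q -> measurable Q) -> (forall Q, D Q -> mu Q = 0) ->
  exists N, [/\ measurable N, mu N = 0 & forall Q, D Q -> Q `<=` N].
Proof.
move=> /pcard_surjP[g gD] mD D0.
pose F k := if `[< D (g k) >] then g k else set0.
have mF k : measurable (F k).
  by rewrite /F; case: asboolP => // /mD.
have F0 k : mu.-negligible (F k).
  rewrite /F; case: asboolP => [Dg|_]; last exact: negligible_set0.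
  by apply/negligibleP; [exact: mD|exact: D0].
exists (\bigcup_k F k); split.
- exact: bigcupT_measurable.
- apply/negligibleP; first exact: bigcupT_measurable.
  exact: negligible_bigcup.
- move=> Q DQ x Qx; have [k _ gk] := gD Q DQ; exists k => //.
  by rewrite /F gk; case: asboolP.
Qed.

(** The exhausting lists are chosen before [f], so that one sequence serves all points [x] at once
    and monotone convergence applies. *)
Lemma countable_esum_cvg (G : set (set T)) : countable G ->
  exists s : nat -> seq (set T),
    [/\ forall n, uniq (s n), forall n Q, Q \in s n -> G Q &
      forall f : set T -> \bar R, (forall Q, G Q -> 0 <= f Q) ->
        {homo (fun n => \sum_(Q <- s n) f Q) : m n / (m <= n)%N >-> m <= n} /\
        \esum_(Q in G) f Q = limn (fun n => \sum_(Q <- s n) f Q)].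
Proof.
move=> /countable_bijP[B]; rewrite card_eq_sym => /card_set_bijP[e be].
have [efun einj esurj] := be.
exists (fun n => [seq e i | i <- iota 0 n & i \in B]); split.
- move=> n; rewrite map_inj_in_uniq ?filter_uniq ?iota_uniq// => i j.
  rewrite !mem_filter => /andP[iB _] /andP[jB _].
  by apply: einj.
- move=> n Q /mapP[i]; rewrite mem_filter => /andP[iB _] ->.
  by apply: efun; rewrite inE in iB.
- move=> f f0.
  have E n : \sum_(Q <- [seq e i | i <- iota 0 n & i \in B]) f Q =
      \sum_(0 <= i < n | i \in B) f (e i).
    by rewrite big_map big_filter /index_iota subn0.
  have fe0 i : i \in B -> 0 <= f (e i).
    by rewrite inE => Bi; apply: f0; exact: efun.
  split.
    move=> m n mn; rewrite !E.
    by apply: lee_sum_nneg_natr => // i _ iB; exact: fe0.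
  rewrite (reindex_esum _ _ _ _ be) -[in LHS](set_mem_set B) -nneseries_esum//.
  by rewrite (_ : (fun n => \sum_(Q <- _) f Q) =
    (fun n => \sum_(0 <= i < n | i \in B) f (e i))) //; apply/funext => n; exact: E.
Qed.

(** A cube of [D] outside [G] is null or has coefficient zero, so off one null set the sum runs over
    [G]. Monotone convergence carries the bound from finite subfamilies to the whole of [G]. *)
Lemma integral_esum_powR_le (D G : set (set T)) (a : set T -> \bar R) (r : R)
    (K : \bar R) :
  countable D -> (forall Q, D Q -> measurable Q) -> G `<=` D ->
  (forall Q, D Q -> 0 <= a Q) -> (forall Q, G Q -> a Q \is a fin_num) ->
  (forall Q, D Q -> ~ G Q -> mu Q = 0 \/ a Q = 0) -> (0 < r)%R ->
  (forall s : seq (set T), uniq s -> (forall Q, Q \in s -> G Q) ->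
    \int[mu]_x ((\sum_(Q <- s) fine (a Q) * \1_Q x) `^ r)%:E <= K) ->
  \int[mu]_x (\esum_(Q in D) (a Q * (\1_Q x)%:E)) `^ r <= K.
Proof.
move=> cD mD GD a0 afin null r0 HK.
have cG : countable G by apply: sub_countable cD; exact: subset_card_le.
have [s [us sG slim]] := countable_esum_cvg cG.
have [N [mN N0 DN]] : exists N, [/\ measurable N, mu N = 0 &
    forall Q, (D Q /\ mu Q = 0) -> Q `<=` N].
  apply: (@null_bigcup [set Q | D Q /\ mu Q = 0]).
  - by apply: sub_countable cD; apply: subset_card_le => Q [].
  - by move=> Q [/mD].
  - by move=> Q [].
pose u n x : R := (\sum_(Q <- s n) fine (a Q) * \1_Q x)%R.
have fa0 Q : G Q -> (0 <= fine (a Q))%R by move=> /GD/a0; exact: fine_ge0.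
have u0 n x : (0 <= u n x)%R.
  by rewrite /u big_seq sumr_ge0// => Q /sG/fa0 ?; rewrite mulr_ge0.
have F0 x Q : D Q -> 0 <= a Q * (\1_Q x)%:E.
  by move=> /a0 ?; rewrite mule_ge0// lee_fin.
have uE n x : \sum_(Q <- s n) (a Q * (\1_Q x)%:E) = (u n x)%:E.
  rewrite /u -sumEFin big_seq [RHS]big_seq; apply: eq_bigr => Q /sG GQ.
  by rewrite EFinM fineK// afin.
have slim' x := slim (fun Q => a Q * (\1_Q x)%:E) (fun Q GQ => F0 x Q (GD _ GQ)).
have uh x : {homo u^~ x : m n / (m <= n)%N >-> (m <= n)%R}.
  by move=> m n mn; have [+ _] := slim' x => /(_ _ _ mn); rewrite !uE lee_fin.
have urh x : {homo (fun n => (u n x `^ r)%:E) : m n / (m <= n)%N >-> m <= n}.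
  by move=> m n mn; rewrite lee_fin powR_le// ?(ltW r0)// uh.
pose h x := limn (fun n => (u n x `^ r)%:E).
have uleh n x : (u n x `^ r)%:E <= h x.
  rewrite /h (cvg_lim _ (ereal_nondecreasing_cvgn (urh x)))//.
  by apply: ereal_sup_ubound; exists n.
have h0 x : 0 <= h x.
  by apply: le_trans (uleh 0%N x); rewrite lee_fin powR_ge0.
have Gh x : (\esum_(Q in G) (a Q * (\1_Q x)%:E)) `^ r <= h x.
  have [hom ->] := slim' x.
  (* Bounding every partial sum by [h x] to the power [r^-1] avoids exchanging the limit with the
     power [r]. *)
  have L : limn (fun n => \sum_(Q <- s n) a Q * (\1_Q x)%:E) <= h x `^ r^-1.
    apply: lime_le; first by apply/cvg_ex; eexists; exact: ereal_nondecreasing_cvgn.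
    apply: nearW => n; rewrite uE.
    rewrite -[u n x]powRr1// -(@mulfV _ r) ?gt_eqF// powRrM -poweR_EFin.
    by apply: poweR_le; rewrite ?invr_ge0 ?(ltW r0)// lee_fin powR_ge0.
  rewrite -[leRHS]poweRe1// -(@mulVf _ r) ?gt_eqF// poweRrM.
  apply: poweR_le => //; first exact: ltW.
  have [_ <-] := slim' x; apply: esum_ge0 => Q GQ; exact: F0 (GD _ GQ).
have DGE x : ~ N x -> \esum_(Q in D) (a Q * (\1_Q x)%:E) =
    \esum_(Q in G) (a Q * (\1_Q x)%:E).
  move=> Nx; rewrite esum_mkcond [RHS]esum_mkcond; apply: eq_esum => Q _.
  have [GQ|GQ] := boolP (Q \in G).
    by rewrite mem_set//; apply: GD; rewrite inE in GQ.
  case: ifPn => // DQ; rewrite inE in DQ.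
  have nGQ : ~ G Q by move=> /mem_set; rewrite (negbTE GQ).
  have [m0|->] := null _ DQ nGQ; last by rewrite mul0e.
  by rewrite indicE memNset ?mule0// => Qx; apply: Nx; exact: (DN Q).
have mu_ n : measurable_fun setT (fun x => (u n x `^ r)%:E).
  apply/measurable_EFinP; apply: (measurableT_comp (measurable_powR r)).
  rewrite /u; under eq_fun do rewrite big_seq big_mkcond/=.
  apply: measurable_sum => Q; have [QS|_] := boolP (Q \in s n);
    last exact: measurable_cst.
  by apply: measurable_funM => //; apply: measurable_indic; exact: mD (GD _ (sG _ _ QS)).
have u0' n x : setT x -> 0 <= (u n x `^ r)%:E by rewrite lee_fin powR_ge0.
have cvgint := @cvg_monotone_convergence _ _ _ mu _ measurableT _ mu_ u0'
  (fun x _ => urh x).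
have mh : measurable_fun setT h.
  apply: (emeasurable_fun_cvg (fun n x => (u n x `^ r)%:E)) => // x _.
  by apply/cvg_ex; eexists; exact: ereal_nondecreasing_cvgn.
have hK : \int[mu]_x h x <= K.
  rewrite /h -(cvg_lim _ cvgint)//; apply: lime_le.
    by apply/cvg_ex; eexists; exact: cvgint.
  by apply: nearW => n; apply: HK; [exact: us|exact: sG].
(* Infinite on the null set [N], [g] makes [h + g] dominate the full sum everywhere at no cost in
   the integral. *)
pose g x := if x \in N then +oo else 0 : \bar R.
have gN : g = (cst +oo) \_ N by apply/funext => x; rewrite /g patchE.
have gE : \int[mu]_x g x = 0.
  by rewrite gN -integral_mkcond integral_cst// N0 mule0.
apply: (@le_trans _ _ (\int[mu]_x (h x + g x))).
  apply: le_integral_nonneg => x; first exact: poweR_ge0.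
  rewrite /g; have [|Nx] := boolP (x \in N).
    by rewrite addey ?leey// -ltNye (lt_le_trans _ (h0 x)).
  by rewrite adde0 DGE ?Gh// => /mem_set; rewrite (negbTE Nx).
rewrite ge0_integralD//; last 2 first.
- by move=> x _; rewrite /g; case: ifP => // _; exact: leey.
- by rewrite gN; apply/(measurable_restrictT _ _).1 => //; exact: measurable_cst.
by rewrite gE adde0.
Qed.

End countable_families.

(** * Dyadic cubes *)

Section dyadic_cubes_facts.
Context (R : realType) (d : nat).

Lemma measurable_dyadic_cube k (m : 'rV[int]_d) :
  measurable (dyadic_cube k m : set (Rd R d)).
Proof.
have lt_meas (i : 'I_d) (b : R) :
    measurable ([set x | x ord0 i < b] : set (Rd R d)).
  apply: sub_sigma_algebra.
  have := @open_comp _ _ (fun x : 'rV[R]_d => x ord0 i) [set y : R | y < b].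
  apply; last exact: open_lt.
  by move=> x _; exact: coord_continuous.
have -> : (dyadic_cube k m : set (Rd R d)) = \bigcap_(i in [set: 'I_d])
    (~` [set x : 'rV[R]_d | x ord0 i < (m ord0 i)%:~R * 2 ^ k] `&`
     [set x : 'rV[R]_d | x ord0 i < ((m ord0 i)%:~R + 1) * 2 ^ k]).
  apply/seteqP; split => x /=.
    move=> Qx i _; have := Qx i; rewrite in_itv/= => /andP[h1 h2].
    by split => //=; apply/negP; rewrite -leNgt.
  move=> Qx i; have [/= /negP + h2] := Qx i I.
  by rewrite -leNgt in_itv/= => ->.
apply: fin_bigcap_measurable => [|i _]; first exact: finite_finset.
by apply: measurableI; [apply: measurableC|]; exact: lt_meas.
Qed.

Lemma measurable_dyadic_cubes (Q : set (Rd R d)) :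
  dyadic_cubes R d Q -> measurable Q.
Proof. by move=> [k [m ->]]; exact: measurable_dyadic_cube. Qed.

Lemma countable_dyadic_cubes : countable (dyadic_cubes R d).
Proof.
have -> : dyadic_cubes R d =
    (fun km : int * 'rV[int]_d => dyadic_cube km.1 km.2) @` setT.
  apply/seteqP; split => [Q [k [m ->]]|_ [[k m] _ <-]].
    by exists (k, m).
  by exists k, m.
by apply: sub_countable (card_image_le _ _) _; exact: countableP.
Qed.

(** In units of [2 ^ k] all endpoints are integers, so the strict inequalities provided by a common
    point improve by one and give containment in every coordinate. *)
Lemma dyadic_cube_nested k k' (m m' : 'rV[int]_d) : (k <= k')%R ->
  dyadic_cube k m `<=` (dyadic_cube k' m' : set (Rd R d)) \/
  (dyadic_cube k' m' : set (Rd R d)) `&` dyadic_cube k m = set0.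
Proof.
move=> kk'; have [[x [Q'x Qx]]|] := pselect
    ((dyadic_cube k' m' : set (Rd R d)) `&` dyadic_cube k m !=set0); last first.
  by move=> n0; right; apply/seteqP; split => // x Xx; apply: n0; exists x.
left => y Qy i; have := Qx i; have := Q'x i; have := Qy i; rewrite !in_itv/=.
set M := m ord0 i; set M' := m' ord0 i; set u := (2 ^ k : R).
have u0 : 0 < u by rewrite exprz_gt0.
have [n kn] : exists n : nat, k' = k + n%:Z.
  by exists `|k' - k|%N; rewrite gez0_abs ?subr_ge0// subrKC.
have -> : (2 ^ k' : R) = (2 ^+ n : int)%:~R * u.
  by rewrite kn exprzDr ?unitfE ?pnatr_eq0// mulrC rmorphXn.
set N : int := 2 ^+ n.
have E (z : int) : z%:~R * (N%:~R * u) = (z * N)%:~R * u by rewrite intrM mulrA.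
rewrite -!intrD1 !E.
move=> /andP[y1 y2] /andP[x1 x2] /andP[x3 x4].
have h1 : (M' * N <= M)%R.
  by rewrite -ltzD1 -(ltr_int R) -(ltr_pM2r u0); exact: le_lt_trans x4.
have h2 : (M + 1 <= (M' + 1) * N)%R.
  by rewrite lezD1 -(ltr_int R) -(ltr_pM2r u0); exact: le_lt_trans x2.
apply/andP; split.
  by apply: le_trans y1; rewrite ler_pM2r// ler_int.
by apply: (lt_le_trans y2); rewrite ler_pM2r// ler_int.
Qed.

(** The closed cube is compact, hence covered by finitely many open sets of finite measure. *)
Lemma dyadic_cubes_finite_measure (mu : {measure set (Rd R d) -> \bar R})
  (Q : set (Rd R d)) : locally_finite mu -> dyadic_cubes R d Q ->
  (mu Q < +oo)%E.
Proof.
move=> lf DQ; have mQ := measurable_dyadic_cubes DQ.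
case: DQ mQ => k [m ->] mQ.
pose B := [set v : 'rV[R]_d | forall i, v ord0 i \in
  `[(m ord0 i)%:~R * 2 ^ k, ((m ord0 i)%:~R + 1) * 2 ^ k] ].
have QB : dyadic_cube k m `<=` B.
  by move=> x Qx i; have := Qx i; rewrite !in_itv/= => /andP[-> /ltW].
have cB : compact B.
  exact: (@rV_compact R d (fun i => `[(m ord0 i)%:~R * 2 ^ k,
    ((m ord0 i)%:~R + 1) * 2 ^ k]%classic) (fun i => @segment_compact _ _ _)).
have [U UP] := choice lf.
move: cB; rewrite compact_cover => /(_ 'rV[R]_d setT U).
have Uo i : setT i -> open (U i) by have [] := UP i.
have UB : B `<=` cover setT U by move=> x _; exists x => //; have [] := UP x.
move=> /(_ Uo UB)[F _ BF].
have mU i : measurable (U i : set (Rd R d)).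
  by apply: sub_sigma_algebra; have [] := UP i.
have H : (mu (dyadic_cube k m) <= \sum_(i \in [set` F]) mu (U i))%E.
  by apply: content_sub_fsum => // x Qx; apply: BF; exact: QB.
apply: (le_lt_trans H); rewrite fsbig_finite//=.
- by apply: lte_sum_pinfty => i _; have [] := UP i.
- exact: finite_fset.
Qed.

(** The cubes are sorted by decreasing scale, ties being harmless; past the end of the list [nth]
    returns the empty set, which lies in every cube. *)
Lemma dyadic_cubes_nested_enum (s : seq (set (Rd R d))) :
  (forall Q, Q \in s -> dyadic_cubes R d Q) ->
  exists s', perm_eq s' s /\ nested (nth set0 s').
Proof.
move=> sD.
have scale (Q : set (Rd R d)) :
    exists k : int, dyadic_cubes R d Q -> exists m, Q = dyadic_cube k m.
  have [[k [m ->]]|nD] := pselect (dyadic_cubes R d Q); last by exists 0%R.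
  by exists k => _; exists m.
have [kap kapP] := choice scale.
pose leT (P Q : set (Rd R d)) := (kap Q <= kap P)%R.
exists (sort leT s); split; first exact: permEl (perm_sort _ _).
have leT_total : total leT by move=> P Q; exact: le_total.
have leT_trans : transitive leT by move=> P Q S h1 h2; exact: le_trans h2 h1.
move=> i j ij; have [js|js] := ltnP j (size (sort leT s)); last first.
  by left; rewrite nth_default.
have is_ : (i < size (sort leT s))%N by exact: ltn_trans js.
have := @sorted_ltn_nth _ leT leT_trans set0 _ (sort_sorted leT_total s) i j.
rewrite !inE is_ js => /(_ isT isT ij); rewrite /leT.
have mems l : (l < size (sort leT s))%N ->
    dyadic_cubes R d (nth set0 (sort leT s) l).
  by move=> ls; apply: sD; rewrite -(mem_sort leT) mem_nth.
have [mj Ej] := kapP _ (mems _ js); have [mi Ei] := kapP _ (mems _ is_).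
by move=> H; rewrite Ej Ei; exact: dyadic_cube_nested.
Qed.

End dyadic_cubes_facts.

(** * The transfer under the Fujii-Wilson condition *)

Section Ainfty.
Context (R : realType) (d : nat).
Implicit Types (sigma omega mu : {measure set (Rd R d) -> \bar R}).
Implicit Types (Q : set (Rd R d)) (F : nat -> set (Rd R d)).

(** If [sigma Q] is positive, dividing by it makes the quotient a lower bound of all admissible
    constants. If it vanishes, any admissible constant already gives the bound zero. *)
Lemma Ainfty_char_attained sigma omega : locally_finite sigma ->
  (Ainfty_char sigma omega < +oo)%E ->
  exists A : R, [/\ 0 <= A, Ainfty_char sigma omega = A%:E &
    forall Q, dyadic_cubes R d Q ->
      (\int[omega]_x ereal_sup [set sigma S / omega S * (\1_S x)%:E
                    | S in [set S | dyadic_cubes R d S /\ S `<=` Q]]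
        <= A%:E * sigma Q)%E].
Proof.
move=> lf fin; have char0 : (0 <= Ainfty_char sigma omega)%E.
  by apply: le_ereal_inf_tmp => _ [C [C0 _] <-]; rewrite lee_fin.
have charE : (fine (Ainfty_char sigma omega))%:E = Ainfty_char sigma omega.
  by rewrite fineK// ge0_fin_numE.
exists (fine (Ainfty_char sigma omega)); split => //; first exact: fine_ge0.
move=> Q DQ; rewrite charE.
have sQ : sigma Q \is a fin_num.
  by rewrite ge0_fin_numE//; exact: dyadic_cubes_finite_measure.
have [s0|s0] := eqVneq (sigma Q) 0%E.
  have [_ [C [C0 CH] <-] _] := ereal_inf_lt fin.
  by have := CH Q DQ; rewrite s0 !mule0.
have sp : 0 < fine (sigma Q).
  by rewrite fine_gt0// lt_neqAle eq_sym s0 measure_ge0 -ge0_fin_numE.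
rewrite -[X in (_ * X)%E](fineK sQ) -lee_pdivrMr//.
apply: le_ereal_inf_tmp => _ [C [C0 CH] <-].
by rewrite lee_pdivrMr// fineK//; exact: CH.
Qed.

(* The other cubes contribute to neither side, up to null sets. *)
Definition charged_cube sigma omega Q :=
  [/\ dyadic_cubes R d Q, (0 < sigma Q)%E & (0 < omega Q)%E].

(** The empty tail keeps every [F i] measurable, as the lemmas on sequences of sets require. *)
Definition charged_family sigma omega F n :=
  [/\ nested F, forall i, (i < n)%N -> charged_cube sigma omega (F i) &
    forall i, (n <= i)%N -> F i = set0].

Lemma charged_familyC sigma omega F n :
  charged_family sigma omega F n -> charged_family omega sigma F n.
Proof. by case=> nF cF F0; split => // i /cF[]. Qed.

Lemma charged_family_measurable sigma omega F n i :
  charged_family sigma omega F n -> measurable (F i).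
Proof.
move=> [_ cF F0]; have [ni|ni] := ltnP i n; last by rewrite F0//.
by have [DF _ _] := cF _ ni; exact: measurable_dyadic_cubes.
Qed.

Lemma charged_family_measure sigma omega F n i : locally_finite sigma ->
  charged_family sigma omega F n -> (i < n)%N ->
  0 < fine (sigma (F i)) /\ sigma (F i) = (fine (sigma (F i)))%:E.
Proof.
move=> lf [_ cF _] ni; have [DF s0 _] := cF _ ni.
have fin := dyadic_cubes_finite_measure lf DF.
by rewrite fineK ?ge0_fin_numE// fine_gt0// s0.
Qed.

Lemma fine_measure_ge0 mu Q : 0 <= fine (mu Q).
Proof. exact: fine_ge0. Qed.

Lemma carleson_Ainfty sigma omega (A : R) F n :
  locally_finite sigma -> locally_finite omega ->
  (forall Q, dyadic_cubes R d Q ->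
    (\int[omega]_x ereal_sup [set sigma S / omega S * (\1_S x)%:E
                    | S in [set S | dyadic_cubes R d S /\ S `<=` Q]]
        <= A%:E * sigma Q)%E) ->
  charged_family sigma omega F n ->
  carleson F n omega (fun i => fine (sigma (F i)) / fine (omega (F i)))
    (fun i => fine (sigma (F i))) A.
Proof.
move=> lfs lfo HA famF j nj; have famF' := charged_familyC famF.
have [nF cF F0] := famF; have [DFj _ _] := cF _ nj.
have [_ sE] := charged_family_measure lfs famF nj.
rewrite EFinM -sE; apply: le_trans (HA _ DFj).
apply: le_integral_nonneg => x; first by rewrite lee_fin max_below_ge0.
rewrite /max_below; apply: (@big_ind _ (fun y => (y%:E <= _)%E)).
(* The initial value 0 of the maximum lies below the nonnegative term of [F j] itself. *)
- apply: (@le_trans _ _ (sigma (F j) / omega (F j) * (\1_(F j) x)%:E)%E).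
    by rewrite !mule_ge0 ?inve_ge0 ?lee_fin.
  by apply: ereal_sup_ubound; exists (F j) => //; split.
- by move=> y z yP zP; rewrite EFin_max ge_max yP zP.
- move=> i /asboolP sub; apply: ereal_sup_ubound; exists (F i).
    by split => //; have [] := cF _ (ltn_ord i).
  have [s0 si] := charged_family_measure lfs famF (ltn_ord i).
  have [w0 wi] := charged_family_measure lfo famF' (ltn_ord i).
  rewrite EFinM EFinM -si; congr (_ * _ * _)%E.
  by rewrite [in LHS]wi inver gt_eqF.
Qed.

(** In terms of norms, [K] is the cost of replacing [L^q(omega)] by [L^q(sigma)], uniformly over
    finite charged families. *)
Definition transfer_bound sigma omega (q K : R) := forall F n (a : nat -> R),
  charged_family sigma omega F n -> (forall i, 0 <= a i) ->
  energy F (fun i => fine (omega (F i))) q a n <= K `^ q *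
  energy F (fun i => fine (sigma (F i))) q
    (fun i => a i * (fine (omega (F i)) / fine (sigma (F i))) `^ (1 / q)) n.

Lemma transfer_bound_le1 sigma omega (q : R) :
  locally_finite sigma -> locally_finite omega ->
  (Ainfty_char sigma omega < +oo)%E -> 0 < q <= 1 ->
  transfer_bound sigma omega q
    (q^-1 * fine (Ainfty_char sigma omega) `^ ((1 - q) / q)).
Proof.
move=> lfs lfo /(Ainfty_char_attained lfs)[A [A0 -> HA]] q01 F n a famF a0.
have /andP[q0 q1] := q01; have qn0 : q != 0 by rewrite gt_eqF.
rewrite powRM ?invr_ge0 ?(ltW q0) ?powR_ge0//= -powRrM divfK//.
have -> : q^-1 `^ q = q `^ (- q) by rewrite -powR_inv1 ?(ltW q0)// -powRrM mulN1r.
have famF' := charged_familyC famF; have [nF _ _] := famF.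
have mF i : measurable (F i) by exact: charged_family_measurable famF.
have s0 i := fine_measure_ge0 sigma (F i).
have w0 i := fine_measure_ge0 omega (F i).
have sp i (ni : (i < n)%N) := (charged_family_measure lfs famF ni).1.
have wp i (ni : (i < n)%N) := (charged_family_measure lfo famF' ni).1.
have wE i (ni : (i < n)%N) := (charged_family_measure lfo famF' ni).2.
exact: (energy_transfer_le1 mF nF s0 w0 sp wp wE q01 A0 a0
  (carleson_Ainfty lfs lfo HA famF)).
Qed.

Lemma transfer_bound_gt1 sigma omega (q : R) :
  locally_finite sigma -> locally_finite omega ->
  (Ainfty_char omega sigma < +oo)%E -> 1 < q ->
  transfer_bound sigma omega q
    (q * fine (Ainfty_char omega sigma) `^ ((q - 1) / q)).
Proof.
move=> lfs lfo /(Ainfty_char_attained lfo)[A [A0 -> HA]] q1 F n a famF a0.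
have q0 : 0 < q by exact: lt_trans q1.
have qn0 : q != 0 by rewrite gt_eqF.
rewrite powRM ?(ltW q0) ?powR_ge0//= -powRrM divfK//.
have famF' := charged_familyC famF; have [nF _ _] := famF.
have mF i : measurable (F i) by exact: charged_family_measurable famF.
have s0 i := fine_measure_ge0 sigma (F i).
have w0 i := fine_measure_ge0 omega (F i).
have sp i (ni : (i < n)%N) := (charged_family_measure lfs famF ni).1.
have wp i (ni : (i < n)%N) := (charged_family_measure lfo famF' ni).1.
have sE i (ni : (i < n)%N) := (charged_family_measure lfs famF ni).2.
exact: (energy_transfer_gt1 mF nF s0 w0 sp wp sE q1 A0 a0
  (carleson_Ainfty lfo lfs HA famF')).
Qed.

End Ainfty.

(** * The operator norm *)

Section Lp_facts.
Context d (T : measurableType d) (R : realType).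
Variables (mu : {measure set T -> \bar R}) (p : R).
Hypothesis p_gt1 : 1 < p.

Lemma Lfun_powR_integral (f : T -> R) : f \in Lfun mu p%:E ->
  measurable_fun setT f /\ exists N : R, [/\ 0 <= N,
    (\int[mu]_x (`|f x| `^ p)%:E = N%:E)%E &
    ('N[mu]_(p%:E)[EFin \o f] = (N `^ p^-1)%:E)%E].
Proof.
move=> fL; have mf : measurable_fun setT f := set_mem (sub_Lfun_mfun fL).
have fin : finite_norm mu p%:E f := set_mem (sub_Lfun_finLfun fL).
split=> //.
have H0 : (0 <= \int[mu]_x (`|f x| `^ p)%:E)%E.
  by apply: integral_ge0 => x _; rewrite lee_fin powR_ge0.
have NE : ('N[mu]_(p%:E)[EFin \o f] = (\int[mu]_x (`|f x| `^ p)%:E) `^ p^-1)%E.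
  by rewrite unlock.
have p0 : p^-1 != 0 by rewrite invr_neq0// gt_eqF// (lt_trans _ p_gt1).
move: fin; rewrite /finite_norm NE => /(lty_poweRy p0) fin.
have finE : (fine (\int[mu]_x (`|f x| `^ p)%:E)%E)%:E =
  (\int[mu]_x (`|f x| `^ p)%:E)%E by rewrite fineK// ge0_fin_numE.
exists (fine (\int[mu]_x (`|f x| `^ p)%:E)%E); split => //.
  exact: fine_ge0.
by rewrite -poweR_EFin finE.
Qed.

Lemma powR_integral_Lfun (f : T -> R) (N : R) : measurable_fun setT f ->
  (\int[mu]_x (`|f x| `^ p)%:E = N%:E)%E -> f \in Lfun mu p%:E.
Proof.
move=> mf NE; apply/andP; split; apply: mem_set => //=.
by rewrite /finite_norm unlock/= NE ltry.
Qed.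

(** Hölder's inequality between [|f|^p] and the indicator of a set of finite measure. *)
Lemma integral_norm_fin_num (f : T -> R) (N : R) (Q : set T) :
  measurable_fun setT f -> (\int[mu]_x (`|f x| `^ p)%:E = N%:E)%E ->
  measurable Q -> (mu Q < +oo)%E ->
  (\int[mu]_(x in Q) `|f x|%:E)%E \is a fin_num.
Proof.
move=> mf NE mQ finQ; have p0 : 0 < p by exact: lt_trans p_gt1.
rewrite ge0_fin_numE; last by apply: integral_ge0 => x _; rewrite lee_fin.
have t01 : 0 < p^-1 <= 1 by rewrite invr_gt0 p0 invf_le1// ltW.
have mu_ : measurable_fun setT (fun x => `|f x| `^ p).
  by apply: (measurableT_comp (measurable_powR p)); exact: measurableT_comp.
have mv : measurable_fun setT (\1_Q : T -> R) by exact: measurable_indic.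
have u0 x : 0 <= `|f x| `^ p by exact: powR_ge0.
have v0 x : 0 <= (\1_Q x : R) by rewrite indicE.
have := holder_interpolation mu t01 mu_ mv u0 v0.
rewrite NE integral_indic// setIT => H.
apply: (@le_lt_trans _ _ (N%:E `^ p^-1 * mu Q `^ (1 - p^-1))%E); last first.
  rewrite poweR_EFin; apply: lte_mul_pinfty; rewrite ?lee_fin ?powR_ge0//.
  exact: poweR_lty.
apply: le_trans H; rewrite integral_mkcond; apply: le_integral_nonneg => x.
  by rewrite patchE; case: ifP => // _; rewrite lee_fin.
rewrite patchE indicE -powRrM mulfV ?gt_eqF// powRr1//.
by case: ifP => _; rewrite lee_fin ?powR1 ?mulr1// mulr_ge0 ?powR_ge0.
Qed.

End Lp_facts.

Lemma seq_le_esum (R : realType) (T : choiceType) (D : set T) (s : seq T)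
    (f : T -> \bar R) : uniq s -> (forall Q, Q \in s -> D Q) ->
  (\sum_(Q <- s) f Q <= \esum_(Q in D) f Q)%E.
Proof.
move=> us sD; apply: esum_ge; exists [set` s]; last by rewrite -fsbig_seq.
by split=> [|Q /=]; [exact: finite_seq|exact: sD].
Qed.

Section operator_norm.
Context (R : realType) (d : nat).
Variables (sigma omega : {measure set (Rd R d) -> \bar R}).
Hypotheses (lfs : locally_finite sigma) (lfo : locally_finite omega).
Variables (lambda : set (Rd R d) -> R).
Hypothesis lambda_ge0 : forall Q, dyadic_cubes R d Q -> 0 <= lambda Q.
Variables (p q : R).
Hypotheses (p_gt1 : 1 < p) (q_gt0 : 0 < q) (q_lt_p : q < p).
Implicit Types (Q : set (Rd R d)) (F : nat -> set (Rd R d)) (f : Rd R d -> R).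

Local Notation D := (dyadic_cubes R d).
Local Notation charged := (charged_cube sigma omega).
Local Notation s_ := (fun Q => fine (sigma Q)).
Local Notation w_ := (fun Q => fine (omega Q)).

(* [lambda] may be negative on [set0], which pads the families [F]. *)
Definition charged_coef Q : R := if `[< charged Q >] then lambda Q else 0.

Lemma charged_coef_ge0 Q : 0 <= charged_coef Q.
Proof. by rewrite /charged_coef; case: asboolP => // -[/lambda_ge0]. Qed.

Lemma charged_coefE Q : charged Q -> charged_coef Q = lambda Q.
Proof. by rewrite /charged_coef; case: asboolP. Qed.

Lemma charged_sigma Q : charged Q -> 0 < s_ Q /\ sigma Q = (s_ Q)%:E.
Proof.
move=> [DQ s0 _]; have fin := dyadic_cubes_finite_measure lfs DQ.
by rewrite fineK ?ge0_fin_numE// fine_gt0// s0.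
Qed.

Lemma charged_omega Q : charged Q -> 0 < w_ Q /\ omega Q = (w_ Q)%:E.
Proof.
move=> [DQ _ w0]; have fin := dyadic_cubes_finite_measure lfo DQ.
by rewrite fineK ?ge0_fin_numE// fine_gt0// w0.
Qed.

(** The identity holds for all coefficients [c], so one family serves both the operator and
    [I_integral]. *)
Lemma charged_seq_family (s : seq (set (Rd R d))) : (forall Q, Q \in s -> charged Q) ->
  exists F n, charged_family sigma omega F n /\
    forall (c : set (Rd R d) -> R) x, \sum_(Q <- s) c Q * \1_Q x =
      \sum_(i < n) c (F i) * \1_(F i) x.
Proof.
move=> sC; have [|t [ts nt]] := @dyadic_cubes_nested_enum R d s.
  by move=> Q /sC[].
exists (nth set0 t), (size t); split.
  split => // i ni; last by rewrite nth_default.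
  by apply: sC; rewrite -(perm_mem ts) mem_nth.
by move=> c x; rewrite -(perm_big _ ts)/= (big_nth set0) big_mkord.
Qed.

Definition weight_coef Q : R := charged_coef Q * (w_ Q / s_ Q) `^ (1 / q).

Lemma weight_coef_ge0 Q : 0 <= weight_coef Q.
Proof. by rewrite mulr_ge0 ?charged_coef_ge0 ?powR_ge0. Qed.

Lemma weight_coefE Q : charged Q ->
  ((lambda Q)%:E * (omega Q / sigma Q) `^ (1 / q) = (weight_coef Q)%:E)%E.
Proof.
move=> cQ; have [s0 sE] := charged_sigma cQ; have [w0 wE] := charged_omega cQ.
rewrite /weight_coef EFinM -poweR_EFin charged_coefE// EFinM -wE.
by rewrite [in LHS]sE inver gt_eqF.
Qed.

Definition average_coef f Q : R := fine (\int[sigma]_(x in Q) `|f x|%:E)%E.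

Lemma average_coef_ge0 f Q : 0 <= average_coef f Q.
Proof. by apply/fine_ge0/integral_ge0 => x _; rewrite lee_fin. Qed.

Lemma average_ge0 f Q : (0 <= average sigma f Q)%E.
Proof. by rewrite mule_ge0 ?inve_ge0//; apply: integral_ge0 => x _. Qed.

Lemma averageE f (N : R) Q : measurable_fun setT f ->
  (\int[sigma]_x (`|f x| `^ p)%:E = N%:E)%E -> charged Q ->
  ((lambda Q)%:E * average sigma f Q =
    (charged_coef Q * (average_coef f Q / s_ Q))%:E)%E.
Proof.
move=> mf NE cQ; have [s0 sE] := charged_sigma cQ; have [DQ _ _] := cQ.
rewrite charged_coefE// EFinM; congr (_ * _)%E; rewrite mulrC EFinM.
rewrite /average [in LHS]sE inver gt_eqF//; congr (_ * _)%E.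
rewrite /average_coef fineK//; apply: (integral_norm_fin_num p_gt1 mf NE).
  exact: measurable_dyadic_cubes.
exact: dyadic_cubes_finite_measure.
Qed.

Lemma average_null f Q : measurable_fun setT f -> D Q -> sigma Q = 0%E ->
  average sigma f Q = 0%E.
Proof.
move=> mf DQ s0; rewrite /average integral_abs_eq0 ?mule0//.
  exact: measurable_dyadic_cubes.
by apply: measurable_funTS; exact/measurable_EFinP.
Qed.

Lemma not_charged Q : D Q -> ~ charged Q -> sigma Q = 0%E \/ omega Q = 0%E.
Proof.
move=> DQ nC; have [s0|s0] := eqVneq (sigma Q) 0%E; first by left.
have [w0|w0] := eqVneq (omega Q) 0%E; first by right.
by exfalso; apply: nC; split => //; rewrite lt_neqAle eq_sym ?s0 ?w0 measure_ge0.
Qed.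

Lemma summation_term_ge0 f x Q : D Q ->
  (0 <= (lambda Q)%:E * average sigma f Q * (\1_Q x)%:E)%E.
Proof.
move=> DQ; rewrite mule_ge0 ?lee_fin//.
by apply: mule_ge0; [rewrite lee_fin lambda_ge0|exact: average_ge0].
Qed.

Lemma Lnorm_dyadic_summation f :
  ('N[omega]_(q%:E)[dyadic_summation lambda sigma f] =
   (\int[omega]_x (dyadic_summation lambda sigma f x) `^ q) `^ q^-1)%E.
Proof.
rewrite unlock; congr (_ `^ _)%E; apply: eq_integral => x _.
by rewrite gee0_abs//; apply: esum_ge0 => Q DQ; exact: summation_term_ge0.
Qed.

Let pq_gt0 : 0 < p - q. Proof. by rewrite subr_gt0. Qed.
Let p_gt0 : 0 < p. Proof. exact: lt_trans p_gt1. Qed.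

Lemma energy_le_I_integral F n (s : seq (set (Rd R d))) :
  uniq s -> (forall Q, Q \in s -> charged Q) ->
  charged_family sigma omega F n ->
  (forall (c : set (Rd R d) -> R) x, \sum_(Q <- s) c Q * \1_Q x =
      \sum_(i < n) c (F i) * \1_(F i) x) ->
  ((energy F (fun i => s_ (F i)) (p * q / (p - q)) (fun i => weight_coef (F i)) n
    `^ ((p - q) / (p * q)))%:E <= I_integral sigma omega p q lambda)%E.
Proof.
move=> us sC famF sumE.
have r0 : 0 < p * q / (p - q) by rewrite divr_gt0// mulr_gt0.
have [nF _ _] := famF.
have mF i : measurable (F i) by exact: charged_family_measurable famF.
have sE i (ni : (i < n)%N) := (charged_family_measure lfs famF ni).2.
have b0 i : 0 <= weight_coef (F i) by exact: weight_coef_ge0.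
have step0 x : 0 <= \sum_(i < n) weight_coef (F i) * \1_(F i) x.
  by apply: sumr_ge0 => i _; rewrite mulr_ge0.
rewrite -poweR_EFin -(integral_powR_step mF nF r0 b0 sE).
apply: poweR_le.
- by rewrite divr_ge0 ?mulr_ge0// ltW.
- by apply: integral_ge0 => x _; rewrite lee_fin powR_ge0.
apply: le_integral_nonneg => x; first by rewrite lee_fin powR_ge0.
rewrite -poweR_EFin; apply: poweR_le; rewrite ?lee_fin ?(ltW r0)//.
rewrite -sumE -sumEFin.
have sD Q : Q \in s -> D Q by move=> /sC[].
apply: le_trans (seq_le_esum _ us sD).
rewrite big_seq [leRHS]big_seq; apply: lee_sum => Q /sC cQ.
by rewrite weight_coefE// EFinM.
Qed.

Lemma operator_norm_le K : 0 <= K -> transfer_bound sigma omega q K ->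
  (dyadic_operator_norm lambda sigma omega p q <=
    (p / (p - 1) * K)%:E * I_integral sigma omega p q lambda)%E.
Proof.
move=> K0 HK; set P := p / (p - 1).
have P0 : 0 <= P by rewrite divr_ge0 ?(ltW p_gt0)// subr_ge0 ltW.
have pn0 : p != 0 by rewrite gt_eqF.
have qn0 : q != 0 by rewrite gt_eqF.
have I0 : (0 <= (P * K)%:E * I_integral sigma omega p q lambda)%E.
  by rewrite mule_ge0 ?poweR_ge0// lee_fin mulr_ge0.
(* An infinite bound is trivial; a finite one is a real [r], shown to be admissible in the infimum.
   Only the product has to be finite, which covers [K = 0] with an infinite [I_integral]. *)
case KI : ((P * K)%:E * I_integral sigma omega p q lambda)%E I0 => [r| |]//;
  last by move=> _; exact: leey.
rewrite lee_fin => r0; apply: ereal_inf_lbound; exists r => //; split => // f fL.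
have [mf [N [N0 NE ->]]] := Lfun_powR_integral p_gt1 fL.
rewrite Lnorm_dyadic_summation.
have rN0 : 0 <= r * N `^ p^-1 by rewrite mulr_ge0// powR_ge0.
suff H : (\int[omega]_x (dyadic_summation lambda sigma f x) `^ q <=
    ((r * N `^ p^-1) `^ q)%:E)%E.
  rewrite -EFinM -[X in (_ <= X%:E)%E](powRr1 rN0) -(mulfV qn0) powRrM -poweR_EFin.
  apply: poweR_le => //; first by rewrite invr_ge0 ltW.
  by apply: integral_ge0 => x _; exact: poweR_ge0.
apply: (@integral_esum_powR_le _ _ _ _ D charged
  (fun Q => (lambda Q)%:E * average sigma f Q)%E) => //.
- exact: countable_dyadic_cubes.
- exact: measurable_dyadic_cubes.
- by move=> Q [].
- by move=> Q DQ; apply: mule_ge0; [rewrite lee_fin lambda_ge0|exact: average_ge0].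
- by move=> Q cQ; rewrite (averageE mf NE).
(* The integral is against [omega]: an [omega]-null cube is invisible, and on a [sigma]-null cube
   the average is zero. *)
- move=> Q DQ /(not_charged DQ)[s0|w0]; [right|by left].
  by rewrite average_null ?mule0.
move=> s us sC; have [F [n [famF sumE]]] := charged_seq_family sC.
have [nF cF _] := famF.
pose a i := charged_coef (F i) * (average_coef f (F i) / s_ (F i)).
have sumx x : \sum_(Q <- s) fine ((lambda Q)%:E * average sigma f Q)%E * \1_Q x =
    \sum_(i < n) a i * \1_(F i) x.
  rewrite sumE; apply: eq_bigr => i _.
  by rewrite (averageE mf NE)//; exact: cF.
under eq_integral => x _ do rewrite sumx.
have mF i : measurable (F i) by exact: charged_family_measurable famF.
have s0 i := fine_measure_ge0 sigma (F i).
have sp i (ni : (i < n)%N) := (charged_family_measure lfs famF ni).1.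
have sE i (ni : (i < n)%N) := (charged_family_measure lfs famF ni).2.
have wE i (ni : (i < n)%N) :=
  (charged_family_measure lfo (charged_familyC famF) ni).2.
have a0 i : 0 <= a i.
  by rewrite mulr_ge0 ?charged_coef_ge0// divr_ge0// average_coef_ge0.
rewrite (integral_powR_step mF nF q_gt0 a0 wE) lee_fin.
apply: (le_trans (HK F n a famF a0)).
pose b i := weight_coef (F i).
have b0 i : 0 <= b i by exact: weight_coef_ge0.
(* The weight of the transfer moves from the averages to [lambda], which becomes the one-weight
   coefficient. *)
have -> : (fun i => a i * (w_ (F i) / s_ (F i)) `^ (1 / q)) =
    (fun i => b i * (average_coef f (F i) / s_ (F i))).
  by apply/funext => i; rewrite /a /b /weight_coef mulrAC.
have mh : measurable_fun setT (fun x => `|f x|) by exact: measurableT_comp.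
have hA i (ni : (i < n)%N) :
    (\int[sigma]_(x in F i) `|f x|%:E)%E = (average_coef f (F i))%:E.
  have [DF _ _] := cF _ ni.
  rewrite fineK//; apply: (integral_norm_fin_num p_gt1 mf NE) => //.
  exact: dyadic_cubes_finite_measure.
have A0 i : 0 <= average_coef f (F i) by exact: average_coef_ge0.
have h0 x : 0 <= `|f x| by exact: normr_ge0.
have Hmax := energy_average_le mF nF s0 sp sE p_gt1 mh h0
  NE hA A0 q_gt0 q_lt_p b0.
have Kq0 : 0 <= K `^ q by exact: powR_ge0.
apply: (le_trans (ler_wpM2l Kq0 Hmax)).
have := energy_le_I_integral us sC famF sumE; rewrite -/b.
set E := energy _ _ _ _ _ => HE.
have E0 : 0 <= E.
  by apply: energy_ge0 => //; rewrite divr_ge0 ?mulr_ge0// ltW.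
have PK0 : 0 <= P * K by rewrite mulr_ge0.
have Er : P * K * E `^ ((p - q) / (p * q)) <= r.
  by rewrite -lee_fin -KI EFinM; apply: lee_wpmul2l; rewrite ?lee_fin.
have Eq (y z : R) : 0 <= y -> 0 <= z ->
    K `^ q * ((y `^ p * N) `^ (q / p) * z `^ (1 - q / p)) =
    (y * K * z `^ ((p - q) / (p * q)) * N `^ p^-1) `^ q.
  move=> y0 z0; rewrite !powRM ?mulr_ge0 ?powR_ge0// -!powRrM.
  have -> : p * (q / p) = q by field.
  have -> : (p - q) / (p * q) * q = 1 - q / p by field; rewrite pn0 qn0.
  by have -> : q / p = p^-1 * q; [rewrite mulrC|ring].
rewrite (Eq _ _ P0 E0); apply: powR_le; first exact: ltW.
  by rewrite mulr_ge0 ?powR_ge0// mulr_ge0 ?powR_ge0.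
by rewrite ler_wpM2r// powR_ge0.
Qed.

(** Testing, exchange of the measures and the assumed bound give [E <= (al * K * C)^q * E^(q/p)] for
    the energy [E] of any finite family; as [q < p], the power of [E] is absorbed. *)
Lemma I_integral_le K C : 0 <= K -> transfer_bound omega sigma q K -> 0 <= C ->
  (forall f, f \in Lfun sigma p%:E ->
    ('N[omega]_(q%:E)[dyadic_summation lambda sigma f] <=
      C%:E * 'N[sigma]_(p%:E)[EFin \o f])%E) ->
  (I_integral sigma omega p q lambda <= (p / (p - q) * K * C)%:E)%E.
Proof.
move=> K0 HK C0 HC; set al := p / (p - q); set r := p * q / (p - q).
have pn0 : p != 0 by rewrite gt_eqF.
have qn0 : q != 0 by rewrite gt_eqF.
have pqn0 : p - q != 0 by rewrite gt_eqF.
have r0 : 0 < r by rewrite divr_gt0// mulr_gt0.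
have al0 : 0 < al by rewrite divr_gt0.
have al1 : 1 < al by rewrite ltr_pdivlMr// mul1r gtrBl.
set k := al * K * C.
have k0 : 0 <= k by apply: mulr_ge0 => //; apply: mulr_ge0 => //; exact: ltW.
suff H : (\int[sigma]_x (\esum_(Q in D) ((lambda Q)%:E *
    (omega Q / sigma Q) `^ (1 / q) * (\1_Q x)%:E)) `^ r <= (k `^ r)%:E)%E.
  have kE : k = (k `^ r) `^ ((p - q) / (p * q)).
    rewrite -powRrM (_ : r * _ = 1) ?powRr1//.
    by rewrite /r; field; rewrite pqn0 pn0 qn0.
  rewrite [X in (_ <= X%:E)%E]kE -poweR_EFin; apply: poweR_le => //.
    by rewrite divr_ge0 ?mulr_ge0// ltW.
  by apply: integral_ge0 => x _; exact: poweR_ge0.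
apply: (@integral_esum_powR_le _ _ _ _ D charged
  (fun Q => (lambda Q)%:E * (omega Q / sigma Q) `^ (1 / q))%E) => //.
- exact: countable_dyadic_cubes.
- exact: measurable_dyadic_cubes.
- by move=> Q [].
- by move=> Q DQ; apply: mule_ge0; [rewrite lee_fin lambda_ge0|exact: poweR_ge0].
- by move=> Q cQ; rewrite weight_coefE.
(* Now the integral is against [sigma], and an [omega]-null cube has coefficient zero because
   [1 / q] is nonzero. *)
- move=> Q DQ /(not_charged DQ)[s0|w0]; [by left|right].
  by rewrite w0 mul0e poweR0r ?mule0// div1r invr_neq0.
move=> s us sC; have [F [n [famF sumE]]] := charged_seq_family sC.
have [nF cF F0] := famF.
pose b i := weight_coef (F i).
have sumx x : \sum_(Q <- s) fine ((lambda Q)%:E *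
      (omega Q / sigma Q) `^ (1 / q))%E * \1_Q x =
    \sum_(i < n) b i * \1_(F i) x.
  rewrite sumE; apply: eq_bigr => i _.
  by rewrite weight_coefE//; exact: cF.
under eq_integral => x _ do rewrite sumx.
have mF i : measurable (F i) by exact: charged_family_measurable famF.
have s0 i := fine_measure_ge0 sigma (F i).
have sp i (ni : (i < n)%N) := (charged_family_measure lfs famF ni).1.
have sE i (ni : (i < n)%N) := (charged_family_measure lfs famF ni).2.
have wE i (ni : (i < n)%N) :=
  (charged_family_measure lfo (charged_familyC famF) ni).2.
have b0 i : 0 <= b i by exact: weight_coef_ge0.
rewrite (integral_powR_step mF nF r0 b0 sE) lee_fin.
set E := energy _ _ _ _ _.
have E0 : 0 <= E by apply: energy_ge0 => //; exact: ltW.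
(* The exponent times [p] equals [r], so the integral of [f^p] is the energy [E] to be bounded. *)
pose f x := (\sum_(i < n) b i * \1_(F i) x) `^ (q / (p - q)).
have f0 x : 0 <= f x by exact: powR_ge0.
have mf : measurable_fun setT f.
  apply: (measurableT_comp (measurable_powR (q / (p - q)))).
  exact: measurable_step.
have NE : (\int[sigma]_x (`|f x| `^ p)%:E = E%:E)%E.
  rewrite -(integral_powR_step mF nF r0 b0 sE); apply: eq_integral => x _.
  rewrite ger0_norm// -powRrM (_ : q / (p - q) * p = r)//.
  by rewrite /r; ring.
have fL := powR_integral_Lfun mf NE.
pose A i := average_coef f (F i).
have A0 i : 0 <= A i by exact: average_coef_ge0.
have hA i (ni : (i < n)%N) : (\int[sigma]_(x in F i) (f x)%:E)%E = (A i)%:E.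
  have [DF _ _] := cF _ ni; rewrite /A /average_coef fineK.
    by apply: eq_integral => x _; rewrite ger0_norm.
  apply: (integral_norm_fin_num p_gt1 mf NE) => //.
  exact: dyadic_cubes_finite_measure.
have test := energy_test_le mF nF s0 sp sE p_gt1 q_gt0 q_lt_p b0 hA A0.
pose c i := charged_coef (F i) * (A i / s_ (F i)).
have c0 i : 0 <= c i by rewrite mulr_ge0 ?charged_coef_ge0// divr_ge0.
have ba0 i : 0 <= b i * (A i / s_ (F i)) by rewrite mulr_ge0// divr_ge0.
have := HK F n _ (charged_familyC famF) ba0.
(* The weight of the reverse transfer cancels the one in [b], leaving the coefficients of the
   original operator. *)
rewrite (_ : (fun i => b i * (A i / s_ (F i)) *
    (s_ (F i) / w_ (F i)) `^ (1 / q)) = c); last first.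
  apply/funext => i; rewrite /c /b /weight_coef.
  have [cFi|ncFi] := pselect (charged (F i)); last first.
    by rewrite /charged_coef; case: asboolP => // _; rewrite !mul0r.
  have [si _] := charged_sigma cFi; have [wi _] := charged_omega cFi.
  have inv : (w_ (F i) / s_ (F i)) `^ (1 / q) * (s_ (F i) / w_ (F i)) `^ (1 / q) = 1.
    rewrite -powRM ?divr_ge0 ?(ltW si) ?(ltW wi)//.
    rewrite (_ : _ / _ * _ = 1) ?powR1//.
    by field; rewrite !gt_eqF.
  by rewrite mulrAC -[X in X * _]mulrA inv mulr1.
move=> Htransfer.
have HX : energy F (fun i => w_ (F i)) q c n <= (C * E `^ p^-1) `^ q.
  have := HC f fL; rewrite Lnorm_dyadic_summation.
  have [_ [N [N0 NE' ->]]] := Lfun_powR_integral p_gt1 fL.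
  move: NE'; rewrite NE => -[<-] HN.
  rewrite -lee_fin -(integral_powR_step mF nF q_gt0 c0 wE).
  apply: (@le_trans _ _ (\int[omega]_x
      dyadic_summation lambda sigma f x `^ q)%E).
    apply: le_integral_nonneg => x; first by rewrite lee_fin powR_ge0.
    rewrite -poweR_EFin; apply: poweR_le; first exact: ltW.
      by rewrite lee_fin; apply: sumr_ge0 => i _; rewrite mulr_ge0.
    have sD Q : Q \in s -> D Q by move=> /sC[].
    apply: le_trans (seq_le_esum _ us sD).
    rewrite -(sumE (fun Q => charged_coef Q * (average_coef f Q / s_ Q))).
    rewrite -sumEFin big_seq [leRHS]big_seq; apply: lee_sum => Q /sC cQ.
    by rewrite EFinM (averageE mf NE).
  have T0 : (0 <= \int[omega]_x dyadic_summation lambda sigma f x `^ q)%E.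
    by apply: integral_ge0 => x _; exact: poweR_ge0.
  rewrite -[leLHS]poweRe1// -(mulVf qn0) poweRrM -poweR_EFin.
  by apply: poweR_le; [exact: ltW|exact: poweR_ge0|rewrite EFinM].
have alq0 : 0 <= al `^ q by exact: powR_ge0.
have Kq0 : 0 <= K `^ q by exact: powR_ge0.
have step1 : E <= al `^ q * (K `^ q * (C * E `^ p^-1) `^ q).
  apply: (le_trans test); rewrite ler_wpM2l//.
  by apply: (le_trans Htransfer); rewrite ler_wpM2l.
(* Prepares [powR_absorb] with [y = 1] and exponent [al], for which [1 - al^-1 = q / p]. *)
have -> : k `^ r = (k `^ q) `^ al * 1.
  by rewrite mulr1 -powRrM /al /r mulrA [q * p]mulrC.
apply: powR_absorb => //; first exact: powR_ge0.
rewrite powR1 mulr1 (_ : 1 - al^-1 = p^-1 * q); last first.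
  by rewrite /al; field; rewrite pn0 pqn0.
apply: (le_trans step1); rewrite le_eqVlt; apply/orP; left; apply/eqP.
rewrite /k (powRM q _ C0); last by apply: mulr_ge0 => //; exact: ltW.
rewrite (powRM q (ltW al0) K0) (powRM q C0) ?powR_ge0// -powRrM.
by ring.
Qed.

End operator_norm.

(** * Constants and conclusion *)

Lemma mule_inve_le (R : realType) (m y C : R) (x : \bar R) :
  0 < m -> 0 <= y -> 0 <= C -> (0 <= x)%E -> (x <= (m * y * C)%:E)%E ->
  ((m^-1)%:E * (y%:E)^-1 * x <= C%:E)%E.
Proof.
move=> m0 y0 C0 x0; have [->|yn0] := eqVneq y 0.
  (* The inverse is [+oo] here, but the bound forces [x = 0] and hence a zero product. *)
  rewrite mulr0 mul0r => x0'; have -> : x = 0%E by apply/le_anti; rewrite x0'.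
  by rewrite mule0 lee_fin.
have yp : 0 < y by rewrite lt_neqAle eq_sym yn0.
move=> H; rewrite inver (negbTE yn0) -EFinM.
have my0 : 0 <= m^-1 / y by rewrite divr_ge0 ?invr_ge0 ?(ltW m0).
apply: (@le_trans _ _ ((m^-1 / y)%:E * (m * y * C)%:E)%E).
  by apply: lee_wpmul2l; rewrite ?lee_fin.
rewrite -EFinM lee_fin le_eqVlt; apply/orP; left; apply/eqP.
by field; rewrite yn0 gt_eqF.
Qed.

Local Open Scope ereal_scope.

(* A negative power A^(-r) is written (A `^ r)^-1, so that it is +oo when A = 0
   and r > 0; the library's 0 `^ (- r) would be 0. *)
Theorem proposition2p2 (R : realType) (p q : R)
    (p_gt1 : (1 < p)%R) (q_gt0 : (0 < q)%R) (q_lt_p : (q < p)%R) :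
  exists c1 c2 : R, [/\ (0 < c1)%R, (0 < c2)%R &
    forall (d : nat) (sigma omega : {measure set (Rd R d) -> \bar R})
      (lambda : set (Rd R d) -> R),
      (0 < d)%N ->
      locally_finite sigma -> locally_finite omega ->
      Ainfty_char sigma omega < +oo -> Ainfty_char omega sigma < +oo ->
      (forall Q, dyadic_cubes R d Q -> (0 <= lambda Q)%R) ->
      ((q <= 1)%R ->
        c1%:E * (Ainfty_char omega sigma `^ ((1 - q) / q))^-1
            * I_integral sigma omega p q lambda
          <= dyadic_operator_norm lambda sigma omega p q /\
        dyadic_operator_norm lambda sigma omega p q
          <= c2%:E * Ainfty_char sigma omega `^ ((1 - q) / q)
            * I_integral sigma omega p q lambda) /\
      ((1 < q)%R ->
        c1%:E * (Ainfty_char sigma omega `^ ((q - 1) / q))^-1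
            * I_integral sigma omega p q lambda
          <= dyadic_operator_norm lambda sigma omega p q /\
        dyadic_operator_norm lambda sigma omega p q
          <= c2%:E * Ainfty_char omega sigma `^ ((q - 1) / q)
            * I_integral sigma omega p q lambda)].
Proof.
(* The numerical factor of the transfer constants in either range of [q]. *)
pose kq := if (q <= 1)%R then q^-1%R else q.
have kq0 : (0 < kq)%R by rewrite /kq; case: ifP => _; rewrite ?invr_gt0.
have p0 : (0 < p)%R by exact: lt_trans p_gt1.
have al0 : (0 < p / (p - q))%R by rewrite divr_gt0// subr_gt0.
have P0 : (0 < p / (p - 1))%R by rewrite divr_gt0// subr_gt0.
exists ((p / (p - q) * kq)^-1)%R, (p / (p - 1) * kq)%R; split.
- by rewrite invr_gt0 mulr_gt0.
- by rewrite mulr_gt0.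
move=> d sigma omega lambda _ lfs lfo fin_so fin_os lambda0.
have upper (e A : R) : (0 <= A)%R -> transfer_bound sigma omega q (kq * A `^ e) ->
    dyadic_operator_norm lambda sigma omega p q <=
    (p / (p - 1) * kq)%:E * A%:E `^ e * I_integral sigma omega p q lambda.
  move=> A0 H; rewrite poweR_EFin -EFinM -[(_ * kq * _)%R]mulrA.
  apply: operator_norm_le => //.
  by rewrite mulr_ge0 ?powR_ge0// ltW.
have lower (e A : R) : (0 <= A)%R -> transfer_bound omega sigma q (kq * A `^ e) ->
    ((p / (p - q) * kq)^-1)%:E * (A%:E `^ e)^-1 *
      I_integral sigma omega p q lambda <=
    dyadic_operator_norm lambda sigma omega p q.
  move=> A0 H; apply: le_ereal_inf_tmp => _ [C [C0 HC] <-].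
  rewrite poweR_EFin; apply: mule_inve_le => //.
  - by rewrite mulr_gt0.
  - exact: powR_ge0.
  - exact: poweR_ge0.
  - rewrite -[(_ * kq * _)%R]mulrA.
    apply: I_integral_le => //.
    by rewrite mulr_ge0 ?powR_ge0// ltW.
have [A1 [A10 E1 _]] := Ainfty_char_attained lfs fin_so.
have [A2 [A20 E2 _]] := Ainfty_char_attained lfo fin_os.
split => [q1|q1].
  have q01 : (0 < q <= 1)%R by rewrite q_gt0.
  have Hso := transfer_bound_le1 lfs lfo fin_so q01.
  have Hos := transfer_bound_le1 lfo lfs fin_os q01.
  rewrite E1 in Hso *; rewrite E2 in Hos *.
  have kqE : kq = q^-1%R by rewrite /kq q1.
  by split; [apply: lower|apply: upper] => //; rewrite kqE.
(* For [q > 1] the transfer from [omega] to [sigma] costs the opposite characteristic, which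
   explains the interchange in the statement. *)
have Hso := transfer_bound_gt1 lfs lfo fin_os q1.
have Hos := transfer_bound_gt1 lfo lfs fin_so q1.
rewrite E1 in Hos *; rewrite E2 in Hso *.
have kqE : kq = q by rewrite /kq leNgt q1.
by split; [apply: lower|apply: upper] => //; rewrite kqE.
Qed.
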